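(* Let $F\subset\mathrm{Sym}^2(\mathbb{R}^n)$ be a cone subequation such that $-P_e\notin F$ for every unit vector $e$. Let $\Omega\subset\mathbb{R}^n$ be a bounded domain with smooth strictly $F$-convex boundary, let $x_1,\dots,x_k\in\Omega$ be distinct, and let $r_0>0$ be such that the closed balls $\overline B_{r_0}(x_j)$ are mutually disjoint and contained in $\Omega$; for $0<r\le r_0$ set $D_r=\bigcup_j\overline B_r(x_j)$ and $\Omega_r=\Omega\setminus D_r$. Let $\varphi\in C(\partial\Omega)$ and let $\psi$ be an $F$-subharmonic function on $\Omega$ with $\psi|_{\partial\Omega}\le\varphi$ and such that either (polar case) $\psi:\overline\Omega\to[-\infty,\infty)$ is continuous and equals $-\infty$ exactly at $x_1,\dots,x_k$, or (finite case) $\psi\in C(\overline\Omega)$ and each $x_j$ is a strict local minimum point of $\psi$ at which $\psi$ has no test functions. Let $H_r(x)=\sup_{u\in\mathcal F_r}u(x)$, where $\mathcal F_r$ is the family of all $u\in\mathrm{USC}(\overline{\Omega_r})$ which are $F$-subharmonic on $\Omega_r$ with $u\le\psi$ on $\partial D_r$ and $u\le\varphi$ on $\partial\Omega$. Then $H_r\in C(\overline{\Omega_r})$, $H_r$ is $F$-harmonic on $\Omega_r$, $H_r|_{\partial D_r}=\psi|_{\partial D_r}$ and $H_r|_{\partial\Omega}=\varphi$.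
   Context: A cone subequation is a closed $F\subset\mathrm{Sym}^2(\mathbb{R}^n)$ with $A\in F,P\ge0\Rightarrow A+P\in F$ and $tF=F$ for $t>0$; $\tilde F=\{A:-A\notin\mathrm{Int}F\}$; $P_e$ is orthogonal projection onto $\mathbb{R}e$. $F$-subharmonic: upper semicontinuous $[-\infty,\infty)$-valued $u$ with $D^2\phi(y)\in F$ for every $C^2$ test function $\phi$ at $y$ ($u\le\phi$ near $y$, equality at $y$); $F$-harmonic: finite, continuous, $F$-subharmonic with $-u$ $\tilde F$-subharmonic. Smooth boundary strictly $F$-convex: for each $x\in\partial\Omega$ and local defining function $\rho$ ($\Omega=\{\rho<0\}$, $\nabla\rho\ne0$), $D^2\rho(x)+tP_\nu\in\mathrm{Int}F$ for all large $t$, $\nu$ the unit normal. *)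

(* Defs.v *)
From HB Require Import structures.
From mathcomp Require Import all_boot all_order all_algebra.
From mathcomp Require Import all_classical all_reals all_analysis.
Set Implicit Arguments. Unset Strict Implicit. Unset Printing Implicit Defensive.
Import Order.TTheory GRing.Theory Num.Theory.
Import numFieldNormedType.Exports.
Local Open Scope classical_set_scope.
Local Open Scope ring_scope.

Section Defs.
Variables (R : realType) (n : nat).
Notation V := 'rV[R]_n.
Notation M := 'M[R]_n.

Definition enorm (x : V) : R := Num.sqrt (\sum_i x ord0 i ^+ 2).

Definition cball (c : V) (r : R) : set V := [set y | enorm (y - c) <= r].

Definition evec (i : 'I_n) : V := delta_mx ord0 i.

Definition grad (f : V -> R) (x : V) : V := \row_i ('D_(evec i) f) x.
Definition hess (f : V -> R) (x : V) : M :=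
  \matrix_(i, j) ('D_(evec i) ('D_(evec j) f)) x.

Definition dpart (s : seq 'I_n) (f : V -> R) : V -> R :=
  foldr (fun i g => 'D_(evec i) g) f s.

Definition C2_on (U : set V) (f : V -> R) : Prop :=
  (forall x, U x -> differentiable f x) /\
  (forall j x, U x -> differentiable ('D_(evec j) f) x) /\
  (forall i j, {within U, continuous ('D_(evec i) ('D_(evec j) f))}).

Definition C2_near (y : V) (f : V -> R) : Prop :=
  exists2 d : R, 0 < d & C2_on [set z | enorm (z - y) < d] f.

Definition smooth_on (U : set V) (f : V -> R) : Prop :=
  forall (s : seq 'I_n) x, U x -> differentiable (dpart s f) x.

Definition symmetric (A : M) : Prop := A^T = A.
Definition psd (P : M) : Prop :=
  symmetric P /\ forall v : V, 0 <= (v *m P *m v^T) ord0 ord0.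

(* orthogonal projection onto R e, for e a unit vector: e^T e *)
Definition projP (e : V) : M := e^T *m e.

Definition IntF (F : set M) : set M :=
  [set A | F A /\ exists2 eps : R, 0 < eps &
     forall B, symmetric B -> `|B - A| < eps -> F B].

Definition dualF (F : set M) : set M :=
  [set A | symmetric A /\ ~ IntF F (- A)].

Definition cone_subequation (F : set M) : Prop :=
  [/\ F `<=` symmetric, closed F,
      (forall A P, F A -> psd P -> F (A + P)) &
      (forall t : R, 0 < t -> [set t *: A | A in F] = F)].

Definition usc_on (X : set V) (u : V -> \bar R) : Prop :=
  (forall x, X x -> u x < +oo)%E /\
  forall x, X x -> forall c : R, (u x < c%:E)%E ->
    exists2 d : R, 0 < d &
      forall y, X y -> enorm (y - x) < d -> (u y < c%:E)%E.

Definition test_fun (u : V -> \bar R) (y : V) (phi : V -> R) : Prop :=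
  C2_near y phi /\ u y = (phi y)%:E /\
  exists2 d : R, 0 < d &
    forall z, enorm (z - y) < d -> (u z <= (phi z)%:E)%E.

Definition subharmonic (G : set M) (X : set V) (u : V -> \bar R) : Prop :=
  usc_on X u /\
  forall y phi, X y -> test_fun u y phi -> G (hess phi y).

Definition F_harmonic (F : set M) (X : set V) (u : V -> \bar R) : Prop :=
  [/\ (forall x, X x -> u x \is a fin_num),
      {within X, continuous u},
      subharmonic F X u &
      subharmonic (dualF F) X (fun x => - u x)%E].

Definition domain (X : set V) : Prop := open X /\ connected X /\ X !=set0.

Definition bdry (X : set V) : set V := closure X `\` interior X.

Definition local_defining_fun (Om : set V) (x : V) (rho : V -> R) : Prop :=
  exists U : set V, [/\ open U, U x, smooth_on U rho,
     (forall y, U y -> grad rho y != 0) &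
     (forall y, U y -> (Om y <-> rho y < 0))].

Definition smooth_boundary (Om : set V) : Prop :=
  forall x, bdry Om x -> exists rho, local_defining_fun Om x rho.

Definition strictly_F_convex_boundary (F : set M) (Om : set V) : Prop :=
  smooth_boundary Om /\
  forall x rho, bdry Om x -> local_defining_fun Om x rho ->
    exists t0 : R, forall t : R, t0 <= t ->
      IntF F (hess rho x + t *: projP ((enorm (grad rho x))^-1 *: grad rho x)).

Definition strict_local_min (psi : V -> \bar R) (x : V) : Prop :=
  exists2 d : R, 0 < d &
    forall y, y != x -> enorm (y - x) < d -> (psi x < psi y)%E.

End Defs.

(* Main.v *)
(** The argument is Perron's method with Walsh's translation trick, and needs no
comparison principle.  As [- P_e] is never in [F], the function
[- C (rho + (t/2) <grad rho, h>^2 - d |h|^2)] is, for large [t], a strict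
supersolution near a boundary point where [rho] defines the domain; it bounds
the whole family from above, on [bdry Om] as well as on the spheres [bdry Dr].
Lower bounds come from [psi] itself on [bdry Dr] and, on [bdry Om], from gluing
[psi] with the same function with the opposite sign, which is a subsolution by
strict convexity.  Hence the upper semicontinuous envelope of [H] belongs to the
family and equals [H].  By the boundary estimates, the maximum of [H] and
[H (. + y) - e], extended by [H], is again in the family when [y] is small, so
that [H] is uniformly continuous; a bump argument shows that [- H] is
subharmonic for the dual of [F].

Test functions enter only through their second-order Taylor polynomials, so
subharmonicity at a point is tested with quadratic polynomials ([sub2_at]). *)
Require Import Defs.
From HB Require Import structures.
From mathcomp Require Import all_boot all_order all_algebra.
From mathcomp Require Import all_classical all_reals all_analysis.
From mathcomp Require Import ring lra.
Set Implicit Arguments.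
Unset Strict Implicit.
Unset Printing Implicit Defensive.
Import Order.TTheory GRing.Theory Num.Theory.
Import numFieldNormedType.Exports.
Local Open Scope classical_set_scope.
Local Open Scope ring_scope.

(** * Quadratic polynomials and norms *)

Section QuadraticForms.
Variables (R : realType) (n : nat).
Notation V := 'rV[R]_n.
Notation M := 'M[R]_n.
Implicit Types (p h k v x y z : V) (A B : M) (a c d e s t : R).

(** The two sides of a boundary estimate have different sources. The upper one works at any smooth
    hypersurface: for suitable large [t] the rank-one term [- t <grad rho, h>^2] outweighs every
    curvature, because [F] is a closed cone without any [- P_e]. It therefore also serves on the
    inner spheres, where the domain lies outside a ball and is concave. The lower one depends on
    curvature: strict convexity supplies it on the outer boundary, while on the spheres [psi]
    already has the right boundary values.

    Supersolutions are taken with Hessian outside [F]. As [F] is closed, this is an open condition,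
    which survives near the boundary point and is contradicted at once by an interior maximum of the
    difference.

    Walsh's argument rests on [F] being the same at all points, so that translates of subsolutions
    are subsolutions. It yields continuity before anything is known about [- H], and in particular
    the semicontinuity that the dual condition demands. *)

Definition dot p h : R := \sum_i p ord0 i * h ord0 i.
Definition qf A h : R := dot (h *m A) h.
Definition quad c p A h : R := c + dot p h + 2^-1 * qf A h.

Lemma dotC p h : dot p h = dot h p.
Proof. by apply: eq_bigr => i _; rewrite mulrC. Qed.

Lemma dotDl p k h : dot (p + k) h = dot p h + dot k h.
Proof. by rewrite -big_split; apply: eq_bigr => i _; rewrite mxE mulrDl. Qed.

Lemma dotZl a p h : dot (a *: p) h = a * dot p h.
Proof. by rewrite mulr_sumr; apply: eq_bigr => i _; rewrite mxE mulrA. Qed.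

Lemma dotDr p h k : dot p (h + k) = dot p h + dot p k.
Proof. by rewrite dotC dotDl !(dotC p). Qed.

Lemma dotZr a p h : dot p (a *: h) = a * dot p h.
Proof. by rewrite dotC dotZl (dotC p). Qed.

Lemma dotNl p h : dot (- p) h = - dot p h.
Proof. by rewrite -scaleN1r dotZl mulN1r. Qed.

Lemma dotE p h : dot p h = (p *m h^T) ord0 ord0.
Proof. by rewrite mxE; apply: eq_bigr => i _; rewrite mxE. Qed.

Lemma dot_adj A h k : dot (h *m A) k = dot (k *m A^T) h.
Proof.
rewrite [RHS]dotC !dotE trmx_mul trmxK mulmxA //.
Qed.

Lemma dot_evec p j : dot p (evec R j) = p ord0 j.
Proof.
rewrite /dot (bigD1 j) //= big1 => [|i ij]; first by rewrite mxE !eqxx mulr1 addr0.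
by rewrite mxE (negPf ij) andbF mulr0.
Qed.

Lemma qfE A h : qf A h = (h *m A *m h^T) ord0 ord0.
Proof. exact: dotE. Qed.

Lemma qfDl A B h : qf (A + B) h = qf A h + qf B h.
Proof. by rewrite /qf mulmxDr dotDl. Qed.

Lemma qfZl a A h : qf (a *: A) h = a * qf A h.
Proof. by rewrite /qf -scalemxAr dotZl. Qed.

Lemma qfNl A h : qf (- A) h = - qf A h.
Proof. by rewrite -scaleN1r qfZl mulN1r. Qed.

Lemma qfZr A a h : qf A (a *: h) = a ^+ 2 * qf A h.
Proof. by rewrite /qf -scalemxAl dotZl dotZr mulrA. Qed.

Lemma qf1 h : qf 1%:M h = dot h h.
Proof. by rewrite /qf mulmx1. Qed.

Lemma qf_scalar a h : qf a%:M h = a * dot h h.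
Proof. by rewrite -scalemx1 qfZl qf1. Qed.

Lemma qf0 A : qf A 0 = 0.
Proof. by rewrite -(scale0r 0) qfZr expr0n mul0r. Qed.

Lemma dot0 p : dot p 0 = 0.
Proof. by rewrite -(scale0r 0) dotZr mul0r. Qed.

Lemma quad0 c p A : quad c p A 0 = c.
Proof. by rewrite /quad dot0 qf0 mulr0 !addr0. Qed.

Lemma qfD A h k : A^T = A -> qf A (h + k) = qf A h + 2 * dot (h *m A) k + qf A k.
Proof.
move=> sA; rewrite /qf mulmxDl !(dotDl, dotDr) (dot_adj A k h) sA; ring.
Qed.

(** Taylor's formula, exact for quadratic polynomials; continuity, first derivatives and jets of
    [quad] are all read off from it. *)
Lemma quad_shift c p A h k : A^T = A ->
  quad c p A (h + k) = quad (quad c p A h) (p + h *m A) A k.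
Proof. by move=> sA; rewrite /quad (qfD _ _ sA) dotDr dotDl; field. Qed.

Lemma coord_le_norm m1 m2 (A : 'M[R]_(m1, m2)) i j : `|A i j| <= `|A|.
Proof.
rewrite [leRHS]/Num.norm /= mx_normrE.
by apply/bigmax_geP; right => /=; exists (i, j).
Qed.

Lemma norm_le_coord m1 m2 (A : 'M[R]_(m1, m2)) c :
  0 <= c -> (forall i j, `|A i j| <= c) -> `|A| <= c.
Proof.
move=> c0 Ac; rewrite [leLHS]/Num.norm /= mx_normrE.
by apply/bigmax_leP; split => // -[i j] _; exact: Ac.
Qed.

Lemma dot_ge0 h : 0 <= dot h h.
Proof. by apply: sumr_ge0 => i _; rewrite -expr2 sqr_ge0. Qed.

(** The norm of a row vector is the sup norm, whereas the definitions use the Euclidean [enorm].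
    Radii of balls are measured below in the former and quadratic terms in [dot]; this inequality is
    the direction needed to bound the latter from below outside a ball. *)
Lemma sqr_norm_le_dot h : `|h| ^+ 2 <= dot h h.
Proof.
rewrite -[leRHS](sqr_sqrtr (dot_ge0 h)) lerXn2r ?nnegrE ?sqrtr_ge0 //.
apply: norm_le_coord => [|i j]; first exact: sqrtr_ge0.
rewrite -sqrtr_sqr ler_wsqrtr // !ord1 /dot (bigD1 j) //= expr2 lerDl.
by apply: sumr_ge0 => k _; rewrite -expr2 sqr_ge0.
Qed.

Lemma sum_ord_le_const (f : 'I_n -> R) c :
  (forall i, f i <= c) -> \sum_i f i <= n%:R * c.
Proof.
move=> fc; apply: le_trans (ler_sum _ (fun i _ => fc i)) _.
by rewrite sumr_const card_ord mulr_natl.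
Qed.

Lemma normr_dot_le p h : `|dot p h| <= n%:R * (`|p| * `|h|).
Proof.
rewrite (le_trans (ler_norm_sum _ _ _))//; apply: sum_ord_le_const => i.
by rewrite normrM ler_pM// coord_le_norm.
Qed.

Lemma dot_gt0 h : h != 0 -> 0 < dot h h.
Proof.
by move=> h0; apply: lt_le_trans (sqr_norm_le_dot h); rewrite exprn_gt0 ?normr_gt0.
Qed.

Lemma enorm_dot h : enorm h = Num.sqrt (dot h h).
Proof. by congr Num.sqrt; apply: eq_bigr => i _; rewrite expr2. Qed.

Lemma enorm_le h c : 0 <= c -> (enorm h <= c) = (dot h h <= c ^+ 2).
Proof.
move=> c0; rewrite enorm_dot -[leRHS](ger0_norm c0) -sqrtr_sqr.
by rewrite ler_sqrt// sqr_ge0.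
Qed.

Lemma norm_le_enorm h : `|h| <= enorm h.
Proof.
rewrite enorm_dot -[leLHS]normr_id -sqrtr_sqr ler_wsqrtr//.
exact: sqr_norm_le_dot.
Qed.

(** The crude constant [n.+1], instead of the square root of [n], is positive even for [n = 0], so
    that [nbhs_enormP] can divide by it. *)
Lemma enorm_le_norm h : enorm h <= n.+1%:R * `|h|.
Proof.
rewrite enorm_le ?mulr_ge0// (le_trans (ler_norm _))//.
rewrite (le_trans (normr_dot_le _ _))// exprMn -expr2 ler_wpM2r ?sqr_ge0//.
by rewrite expr2 -natrM ler_nat mulSn (leq_trans (leqnSn n))// leq_addr.
Qed.

Lemma nbhs_norm_subP m1 m2 (x : 'M[R]_(m1, m2)) (P : set 'M[R]_(m1, m2)) :
  nbhs x P <-> exists2 d : R, 0 < d & forall B : 'M[R]_(m1, m2), `|B - x| < d -> P B.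
Proof.
split=> [/nbhs_ballP[d d0 xP]|[d d0 xP]].
  by exists d => // B Bx; apply: xP; rewrite -ball_normE /= distrC.
apply/nbhs_ballP; exists d => // B.
by rewrite -ball_normE /= distrC; exact: xP.
Qed.

Lemma nbhs_enormP x (P : set V) :
  nbhs x P <-> exists2 d, 0 < d & forall z, enorm (z - x) < d -> P z.
Proof.
rewrite nbhs_norm_subP; split=> -[d d0 dP].
  by exists d => // z zd; apply/dP/(le_lt_trans _ zd)/norm_le_enorm.
exists (d / n.+1%:R) => [|z]; first by rewrite divr_gt0.
rewrite ltr_pdivlMr// mulrC => zd; apply: dP.
exact: le_lt_trans (enorm_le_norm _) zd.
Qed.

Lemma near_and x (P Q : set V) :
  nbhs x P -> nbhs x Q -> nbhs x (fun z => P z /\ Q z).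
Proof. by move=> xP xQ; apply: (@filterI _ _ (nbhs_filter x)). Qed.

Lemma near_norm_lt x e : 0 < e -> \forall z \near x, `|z - x| < e.
Proof. by move=> e0; apply/nbhs_norm_subP; exists e. Qed.

Lemma continuous_atP (f : V -> R) x :
  {for x, continuous f} <->
  forall e, 0 < e -> \forall z \near x, `|f z - f x| < e.
Proof.
split=> [/(@cvgrPdist_lt _ _ _ _ (nbhs_filter x)) fx e e0|fx].
  by have := fx e e0; apply: filterS => z; rewrite distrC.
apply/(@cvgrPdist_lt _ _ _ _ (nbhs_filter x)) => e e0.
by have := fx e e0; apply: filterS => z; rewrite distrC.
Qed.

Lemma continuous_dot p x : {for x, continuous (fun z => dot p (z - x))}.
Proof.
apply/continuous_atP => e e0; near=> z.
rewrite subrr dot0 subr0 (le_lt_trans (normr_dot_le _ _))// mulrA.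
have c0 : 0 < n%:R * `|p| + 1 by rewrite ltr_wpDl// mulr_ge0.
apply: (@le_lt_trans _ _ ((n%:R * `|p| + 1) * `|z - x|)).
  by rewrite ler_wpM2r// lerDl.
rewrite mulrC -ltr_pdivlMr//; near: z; apply: near_norm_lt.
by rewrite divr_gt0.
Unshelve. all: by end_near. Qed.

Lemma qf_bound A h : `|qf A h| <= (n%:R * (n%:R * `|A|)) * `|h| ^+ 2.
Proof.
rewrite (le_trans (normr_dot_le _ _))// -!mulrA ler_wpM2l// expr2 !mulrA ler_wpM2r//.
apply: norm_le_coord => [|i j]; first by rewrite !mulr_ge0.
rewrite mxE -mulrA (le_trans (ler_norm_sum _ _ _))//; apply: sum_ord_le_const => k.
by rewrite normrM mulrC ler_pM// coord_le_norm.
Qed.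

Lemma continuous_quad c p A x : A^T = A ->
  continuous (fun z => quad c p A (z - x)).
Proof.
move=> sA y; apply/continuous_atP => e e0.
have Cy : {for y, continuous (fun z => dot (p + (y - x) *m A) (z - y))}.
  exact: continuous_dot.
move/continuous_atP : Cy => /(_ _ (divr_gt0 e0 (ltr0n _ 2))).
set C := n%:R * (n%:R * `|A|) + 1.
have C0 : 0 < C by rewrite ltr_wpDl// !mulr_ge0.
apply: filter_app; near=> z.
rewrite subrr dot0 subr0 => zy.
have -> : z - x = (y - x) + (z - y) by rewrite [RHS]addrC addrA subrK.
rewrite (quad_shift c p (y - x) (z - y) sA); set Q := quad c _ _ _.
rewrite /quad -[Q + _ + _]addrA [Q + _]addrC addrK.
rewrite (le_lt_trans (ler_normD _ _))// (splitr e) ltrD//.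
rewrite normrM ger0_norm ?invr_ge0// mulrC ltr_pM2r ?invr_gt0//.
rewrite (le_lt_trans (qf_bound _ _))//.
have zy1 : `|z - y| < 1 by near: z; exact: near_norm_lt.
apply: (@le_lt_trans _ _ (C * `|z - y|)).
  apply: ler_pM; rewrite ?lerDl ?mulr_ge0 ?sqr_ge0//.
  by rewrite expr2 ler_piMr// ltW.
rewrite mulrC -ltr_pdivlMr//; near: z; apply: near_norm_lt.
by rewrite divr_gt0.
Unshelve. all: by end_near. Qed.

End QuadraticForms.

(** * Second-order Taylor expansion *)

Section SecondOrderExpansion.
Variables (R : realType) (n : nat).
Notation V := 'rV[R]_n.
Notation M := 'M[R]_n.
Implicit Types (f g : V -> R) (p h k v x y z : V) (A B : M) (a c d e s t : R).

Lemma row_sum_evec h : h = \sum_i h ord0 i *: evec R i.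
Proof. exact: row_sum_delta. Qed.

Lemma norm_evec i : `|evec R i : V| <= 1.
Proof.
by apply: norm_le_coord => // k j; rewrite mxE; case: (_ && _); rewrite ?normr1 ?normr0.
Qed.

Lemma derive_grad f x h : differentiable f x -> 'D_h f x = dot (grad f x) h.
Proof.
move=> df; rewrite deriveE// {1}(row_sum_evec h) linear_sum dotC.
by apply: eq_bigr => i _; rewrite linearZ /= -deriveE// !mxE.
Qed.

Lemma differentiable_expansion f x e : differentiable f x -> 0 < e ->
  \forall z \near x, `|f z - f x - dot (grad f x) (z - x)| <= e * `|z - x|.
Proof.
move=> df e0.
have /eqaddoP/(_ _ e0) := diff_locally df.
move=> /nbhs_norm_subP[d d0 Hd]; apply/nbhs_norm_subP; exists d => // z zx.
have := Hd (z - x); rewrite subr0 => /(_ zx) /=.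
by rewrite !fctE /= subrK opprD addrA -derive_grad// deriveE.
Qed.

Lemma derive_expansion f y e :
  (forall j, differentiable ('D_(evec R j) f) y) -> 0 < e ->
  \forall z \near y, forall j, `|'D_(evec R j) f z - 'D_(evec R j) f y
      - dot (grad ('D_(evec R j) f) y) (z - y)| <= e * `|z - y|.
Proof.
move=> d2f e0.
refine (@filter_forall V 'I_n (fun j z => `|'D_(evec R j) f z - 'D_(evec R j) f y
  - dot (grad ('D_(evec R j) f) y) (z - y)| <= e * `|z - y|) _ (nbhs_filter y) _) => j.
exact: (differentiable_expansion (d2f j) e0).
Qed.

Lemma is_derive_line f x h t : differentiable f (x + t *: h) ->
  is_derive t 1 (fun s => f (x + s *: h)) (dot (grad f (x + t *: h)) h).
Proof.
move=> df; rewrite -derive_grad//.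
have E : (fun s => s^-1 *: ((fun s => f (x + s *: h)) (s *: 1 + t) - f (x + t *: h)))
       = (fun s => s^-1 *: ((f \o shift (x + t *: h)) (s *: h) - f (x + t *: h))).
  apply/funext => s; rewrite /= scalerDl [_ *: 1]mulr1.
  by rewrite addrCA.
apply: DeriveDef; rewrite /derivable /derive /= E //.
exact: diff_derivable df.
Qed.

(* [p] and [A] are the gradient and the Hessian of [f] at [y], in the weak sense of
a second-order Taylor expansion. *)
Definition jet2 f y p A := forall e, 0 < e ->
  \forall z \near y, `|f z - quad (f y) p A (z - y)| <= e * dot (z - y) (z - y).

Lemma is_derive_quad_line c p A h t :
  is_derive t 1 (fun s => quad c p A (s *: h)) (dot p h + t * qf A h).
Proof.
have -> : (fun s => quad c p A (s *: h)) =
   (fun s => c + s * dot p h + s ^+ 2 * (2^-1 * qf A h)).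
  by apply/funext => s; rewrite /quad dotZr qfZr; ring.
apply: is_derive_eq.
by rewrite /GRing.scale /=; field.
Qed.

(** One mean value theorem along the segment from [y] to [z] is enough: the derivative of [f] minus
    its polynomial is the first-order expansion error of the gradient, which is already [o(|h|)],
    paired with [h]. Dividing [e] by [n.+1] absorbs the factor [n] of [normr_dot_le]. *)
Lemma taylor2 f y :
  (\forall z \near y, differentiable f z) ->
  (forall j, differentiable ('D_(evec R j) f) y) ->
  jet2 f y (grad f y) (hess f y).
Proof.
move=> df d2f e e0.
have e'0 : 0 < e / n.+1%:R by rewrite divr_gt0.
have H : \forall z \near y, forall j,
    (`|'D_(evec R j) f z - 'D_(evec R j) f y
      - dot (grad ('D_(evec R j) f) y) (z - y)| <= e / n.+1%:R * `|z - y|).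
  exact: derive_expansion.
have /nbhs_norm_subP[d d0 dP] := near_and df H.
apply/nbhs_norm_subP; exists d => // z zy.
set h : V := z - y.
have near_line t : 0 <= t <= 1 -> `|y + t *: h - y| < d.
  move=> /andP[t0 t1]; rewrite addrC addKr normrZ ger0_norm//.
  by apply: le_lt_trans zy; rewrite ler_piMl.
pose g t := f (y + t *: h) - quad (f y) (grad f y) (hess f y) (t *: h).
pose dg t := dot (grad f (y + t *: h)) h - (dot (grad f y) h + t * qf (hess f y) h).
have gd t : 0 <= t <= 1 -> is_derive t 1 g (dg t).
  move=> t01; apply: is_deriveB; last exact: is_derive_quad_line.
  by apply: is_derive_line; have [] := dP _ (near_line _ t01).
have [t t01] : exists2 t, t \in `]0, 1[%R & g 1 - g 0 = dg t * (1 - 0).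
  apply: MVT => // [t|].
    by rewrite in_itv /= => /andP[/ltW t0 /ltW t1]; apply: gd; rewrite t0.
  apply: derivable_within_continuous => t; rewrite in_itv /= => t01.
  by have [] := gd t t01.
rewrite {1 2}/g !scale1r !scale0r addr0 quad0 subrr subr0 subr0 mulr1.
rewrite [y + h]addrC subrK => ->.
move: t01; rewrite in_itv /= => /andP[/ltW t0 /ltW t1].
have [_ /(_ _) Ht] := dP _ (near_line t (introT andP (conj t0 t1))).
apply: (@le_trans _ _ (e * `|h| ^+ 2)); last first.
  by rewrite ler_wpM2l ?(ltW e0)// sqr_norm_le_dot.
have -> : dg t = dot (\row_j ('D_(evec R j) f (y + t *: h) - 'D_(evec R j) f y
      - dot (grad ('D_(evec R j) f) y) (t *: h))) h.
  rewrite /dg /qf -!dotZl opprD addrA -!dotNl -!dotDl; congr dot.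
  apply/rowP => j; rewrite !mxE; congr (_ - _).
  rewrite dotZr; congr (_ * _).
  by rewrite /dot; apply: eq_bigr => i _; rewrite !mxE mulrC.
apply: (le_trans (normr_dot_le _ _)).
apply: (@le_trans _ _ (n%:R * (e / n.+1%:R * `|h| * `|h|))).
  rewrite ler_wpM2l// ler_wpM2r//; apply: norm_le_coord => [|i j].
    by rewrite mulr_ge0// (ltW e'0).
  rewrite mxE; have := Ht j; rewrite [y + _ - y]addrC addKr => /le_trans; apply.
  rewrite ler_wpM2l ?(ltW e'0)// normrZ ger0_norm//.
  by rewrite ler_piMl.
rewrite -mulrA -expr2 mulrA ler_wpM2r ?sqr_ge0//.
by rewrite mulrA ler_pdivrMr// mulrC ler_wpM2l ?(ltW e0)// ler_nat.
Qed.

(* Clairaut: the second difference in the directions [i] and [j] is symmetric,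
and the mean value theorem turns it into either mixed derivative. *)
Lemma hess_sym f y :
  (\forall z \near y, differentiable f z) ->
  (forall j, differentiable ('D_(evec R j) f) y) ->
  (hess f y)^T = hess f y.
Proof.
move=> df d2f; apply/matrixP => i j; rewrite mxE.
apply/eqP; rewrite -subr_eq0 -normr_le0; apply/ler_addgt0Pr => e e0; rewrite add0r.
(* Two expansion errors, each [e / 8] times a distance at most [2 * s], add up to [e / 2 * s]; the
   two orders of the indices then add up to [e]. *)
have e'0 : 0 < e / 8 by rewrite divr_gt0.
have H : \forall z \near y, forall j,
    `|'D_(evec R j) f z - 'D_(evec R j) f y
      - dot (grad ('D_(evec R j) f) y) (z - y)| <= e / 8 * `|z - y|.
  exact: derive_expansion.
have /nbhs_norm_subP[d d0 dP] := near_and df H.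
pose s : R := d / 4.
have s0 : 0 < s by rewrite divr_gt0.
pose D (k l : 'I_n) := f (y + s *: evec R k + s *: evec R l) - f (y + s *: evec R k)
  - (f (y + s *: evec R l) - f y).
have DC : D i j = D j i.
  by rewrite /D [y + _ + _]addrAC; ring.
suff HD (k l : 'I_n) : `|D k l - s ^+ 2 * hess f y l k| <= e / 2 * s ^+ 2.
  have := HD i j; have := HD j i; rewrite -DC => h1 h2.
  have s2 : 0 < s ^+ 2 by rewrite exprn_gt0.
  rewrite -(ler_pM2r s2) -[X in _ * X <= _](ger0_norm (ltW s2)) -normrM.
  have -> : (hess f y j i - hess f y i j) * s ^+ 2 =
    (D i j - s ^+ 2 * hess f y i j) - (D i j - s ^+ 2 * hess f y j i) by ring.
  apply: (le_trans (ler_normB _ _)); apply: le_trans (lerD h1 h2) _.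
  by rewrite -mulrDl -splitr.
have inball t m : 0 <= t <= s -> (m <= 1)%N ->
    `|y + (m%:R * s) *: evec R l + t *: evec R k - y| <= 2 * s.
  move=> /andP[t0 ts] m1; rewrite [_ - y]addrC -[y + _ + _]addrA addKr.
  apply: (le_trans (ler_normD _ _)); rewrite mulr2n mulrDl mul1r.
  apply: lerD; rewrite normrZ -[leRHS]mulr1; apply: ler_pM; rewrite ?norm_evec//.
    rewrite (ger0_norm (mulr_ge0 (ler0n _ _) (ltW s0))).
    by rewrite -[leRHS]mul1r; apply: ler_wpM2r; [exact: ltW | rewrite lern1].
  by rewrite ger0_norm.
have sd : 2 * s < d by rewrite /s; lra.
pose P (m : nat) t : V := y + (m%:R * s) *: evec R l + t *: evec R k.
pose g t := f (P 1%N t) - f (P 0%N t).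
pose dg t := 'D_(evec R k) f (P 1%N t) - 'D_(evec R k) f (P 0%N t).
have gd t : 0 <= t <= s -> is_derive t 1 g (dg t).
  move=> t01.
  have dfP m : (m <= 1)%N -> differentiable f (P m t).
    by move=> m1; have [] := dP _ (le_lt_trans (inball _ _ t01 m1) sd).
  have dP' m : (m <= 1)%N ->
      is_derive t 1 (fun t => f (P m t)) ('D_(evec R k) f (P m t)).
    move=> m1; rewrite derive_grad; last exact: dfP.
    exact: (@is_derive_line f (y + (m%:R * s) *: evec R l) (evec R k) t (dfP m m1)).
  by apply: is_deriveB; exact: dP'.
have [t t01] : exists2 t, t \in `]0, s[%R & g s - g 0 = dg t * (s - 0).
  apply: MVT => // [t|].
    by rewrite in_itv /= => /andP[/ltW t0 /ltW t1]; apply: gd; rewrite t0.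
  apply: derivable_within_continuous => t; rewrite in_itv /= => t01.
  by have [] := gd t t01.
have -> : g s - g 0 = D k l.
  rewrite /g /D /P !mul1r !mul0r !scale0r !addr0 [y + _ + _]addrAC; ring.
rewrite subr0 => ->.
have -> : dg t * s - s ^+ 2 * hess f y l k = (dg t - s * hess f y l k) * s by ring.
rewrite expr2.
rewrite normrM (ger0_norm (ltW s0)) [e / 2 * _]mulrA ler_pM2r//.
move: t01; rewrite in_itv /= => /andP[/ltW t0 /ltW t1].
have ts : 0 <= t <= s by rewrite t0.
have [_ /(_ k) H1] := dP _ (le_lt_trans (inball t 1%N ts isT) sd).
have [_ /(_ k) H0] := dP _ (le_lt_trans (inball t 0%N ts isT) sd).
have {}H1 := le_trans H1 (ler_wpM2l (ltW e'0) (inball t 1%N ts isT)).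
have {}H0 := le_trans H0 (ler_wpM2l (ltW e'0) (inball t 0%N ts isT)).
have -> : dg t - s * hess f y l k =
  ('D_(evec R k) f (P 1%N t) - 'D_(evec R k) f y - dot (grad ('D_(evec R k) f) y) (P 1%N t - y)) -
  ('D_(evec R k) f (P 0%N t) - 'D_(evec R k) f y - dot (grad ('D_(evec R k) f) y) (P 0%N t - y)).
  have -> : P 1%N t - y = s *: evec R l + (P 0%N t - y).
    by apply/rowP => q; rewrite !mxE; ring.
  by rewrite [dot _ (s *: _ + _)]dotDr dotZr dot_evec !mxE /dg; ring.
apply: (le_trans (ler_normB _ _)); apply: le_trans (lerD H1 H0) _.
by rewrite le_eqVlt; apply/orP; left; apply/eqP; field.
Qed.

End SecondOrderExpansion.

(** * Subsolutions tested by quadratic polynomials *)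

Section Subsolutions.
Variables (R : realType) (n : nat).
Notation V := 'rV[R]_n.
Notation M := 'M[R]_n.
Implicit Types (f g : V -> R) (u v w : V -> \bar R) (p h k x y z : V).
Implicit Types (A B : M) (a c d e s t : R) (F : set M) (X K : set V).

Lemma is_derive_at_line f x k a :
  is_derive (0 : R) 1 (fun s => f (s *: k + x)) a -> is_derive x k f a.
Proof.
case=> df fa; have E : (fun s => s^-1 *: ((fun s => f (s *: k + x)) (s *: 1 + 0)
      - f (0 *: k + x))) = (fun s => s^-1 *: ((f \o shift x) (s *: k) - f x)).
  by apply/funext => s; rewrite /= addr0 [_ *: 1]mulr1 scale0r add0r.
by move: df fa; rewrite /derivable /derive /= E => df fa; apply: DeriveDef.
Qed.

Lemma differentiable_quad c p A y x :
  differentiable (fun z => quad c p A (z - y)) x.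
Proof.
have dc h i : differentiable (fun z => (z - h) ord0 i) x.
  rewrite (_ : (fun z => _) = (fun z => z ord0 i) - cst (h ord0 i)).
    by apply: differentiableB => //; exact: differentiable_coord.
  by apply/funext => z; rewrite !mxE.
have ds (G : 'I_n -> V -> R) : (forall i, differentiable (G i) x) ->
    differentiable (fun z => \sum_i G i z) x.
  move=> dG; rewrite (_ : (fun z => _) = \sum_i G i); first exact: differentiable_sum.
  by apply/funext => z; rewrite fct_sumE.
apply: differentiableD; first apply: differentiableD => //.
  by apply: (ds) => i; apply: differentiableM.
apply: differentiableM => //; apply: (ds) => i; apply: differentiableM => //.
under eq_fun do rewrite mxE.
by apply: (ds) => j; apply: differentiableM.
Qed.

(** The derivative is written as a [quad] with zero matrix so that the same lemma also computes the
    second derivatives. *)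
Lemma derive_quadE c p A y j z : A^T = A ->
  'D_(evec R j) (fun z => quad c p A (z - y)) z =
  quad (p ord0 j) (row j A) 0 (z - y).
Proof.
move=> sA; set q := fun _ => _.
have : is_derive z (evec R j) q
    (dot (p + (z - y) *m A) (evec R j) + 0 * qf A (evec R j)).
  apply: is_derive_at_line; rewrite /q.
  under eq_fun do rewrite -addrA addrC (quad_shift _ _ _ _ sA).
  exact: is_derive_quad_line.
case=> _ ->; rewrite mul0r addr0 dot_evec /quad qfE mulmx0 mul0mx !mxE mulr0 addr0.
congr (_ + _); rewrite dotC /dot; apply: eq_bigr => i _.
by rewrite !mxE -{1}sA mxE.
Qed.

Lemma derive_quad c p A y j : A^T = A ->
  'D_(evec R j) (fun z => quad c p A (z - y)) =
  (fun z => quad (p ord0 j) (row j A) 0 (z - y)).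
Proof. by move=> sA; apply/funext => z; exact: derive_quadE. Qed.

Lemma hess_quad c p A y x : A^T = A -> hess (fun z => quad c p A (z - y)) x = A.
Proof.
move=> sA; apply/matrixP => i j; rewrite mxE derive_quad// derive_quadE ?trmx0//.
have -> : row i (0 : M) = 0 by apply/rowP => k; rewrite !mxE.
by rewrite /quad dotC dot0 qfE mulmx0 mul0mx !mxE mulr0 !addr0 -{1}sA mxE.
Qed.

Lemma C2_near_quad c p A y : A^T = A -> C2_near y (fun z => quad c p A (z - y)).
Proof.
move=> sA; exists 1 => //; split=> [x _|]; first exact: differentiable_quad.
split=> [j x _|i j]; first by rewrite derive_quad//; exact: differentiable_quad.
rewrite derive_quad// derive_quad ?trmx0//; apply: continuous_subspaceT.
by apply: continuous_quad; rewrite trmx0.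
Qed.

Lemma C2_near_jet2 f y : C2_near y f ->
  (hess f y)^T = hess f y /\ jet2 f y (grad f y) (hess f y).
Proof.
move=> [d d0 [df [d2f _]]].
have yd : enorm (y - y) < d by rewrite subrr enorm_dot dot0 sqrtr0.
have df' : \forall z \near y, differentiable f z.
  by apply/nbhs_enormP; exists d.
by split; [apply: hess_sym|apply: taylor2] => // j; exact: d2f.
Qed.

Definition sub2_at F u y := forall c p A, A^T = A -> u y = c%:E ->
  (\forall z \near y, (u z <= (quad c p A (z - y))%:E)%E) -> F A.

Lemma symD A B : A^T = A -> B^T = B -> (A + B)^T = A + B.
Proof. by move=> sA sB; rewrite linearD /= sA sB. Qed.

Lemma sym_scalar a : (a%:M : M)^T = a%:M.
Proof. exact: tr_scalar_mx. Qed.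

Lemma norm_scalar_mx_le a : `|a%:M : M| <= `|a|.
Proof.
apply: norm_le_coord => // i j; rewrite mxE.
by case: (i == j); rewrite ?mulr1n// mulr0n normr0.
Qed.

(** Closedness of [F] pays for the small multiple of the identity that makes a contact strict or
    dominates a Taylor remainder. *)
Lemma closed_addr_scalar F A : closed F ->
  (forall e, 0 < e -> F (A + e%:M)) -> F A.
Proof.
move=> cF FA; apply: cF => U /nbhs_norm_subP[d d0 dU].
exists (A + (d / 2)%:M); split; first by apply: FA; rewrite divr_gt0.
apply: dU; rewrite addrC addKr (le_lt_trans (norm_scalar_mx_le _))//.
by rewrite ger0_norm ?divr_ge0 ?(ltW d0)// ltr_pdivrMr// ltr_pMr// ltr1n.
Qed.

Lemma quad_add_scalar c p A e h :
  quad c p (A + (2 * e)%:M) h = quad c p A h + e * dot h h.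
Proof. by rewrite /quad qfDl qf_scalar; field. Qed.

(** The remainder of the expansion is at most [e / 2 * |h|^2], so the polynomial with Hessian
    [A + e I] touches [u] from above for every [e > 0]. The constant [c - g y] lifts [g] to the
    contact. *)
Lemma sub2_at_jet F u g y p A c : closed F -> sub2_at F u y -> A^T = A ->
  jet2 g y p A -> u y = c%:E ->
  (\forall z \near y, (u z <= (g z + (c - g y))%:E)%E) -> F A.
Proof.
move=> cF uF sA gj uy ug; apply: (closed_addr_scalar cF) => e e0.
apply: (uF c p _ _ uy); first by apply: symD => //; exact: sym_scalar.
have e20 : 0 < e / 2 by rewrite divr_gt0.
have := near_and ug (gj _ e20); apply: filterS => z [/le_trans + gz]; apply.
have -> : e = 2 * (e / 2) by field.
rewrite lee_fin quad_add_scalar.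
have := ler_normlW gz; rewrite /quad => ?; lra.
Qed.

Lemma subharmonic_sub2 F X u y : subharmonic F X u -> X y -> sub2_at F u y.
Proof.
move=> [_ uF] Xy c p A sA uy ule; rewrite -(hess_quad c p y y sA).
apply: uF => //; split; first exact: C2_near_quad.
by split; [rewrite subrr quad0|apply/nbhs_enormP].
Qed.

Lemma sub2_subharmonic F X u : closed F -> usc_on X u ->
  (forall y, X y -> sub2_at F u y) -> subharmonic F X u.
Proof.
move=> cF uX uF; split=> // y f Xy [fC2 [uy ule]].
have [sH jf] := C2_near_jet2 fC2.
apply: (sub2_at_jet cF (uF y Xy) sH jf uy).
move/nbhs_enormP : ule; apply: filterS => z.
by rewrite subrr addr0.
Qed.

Lemma sub2_at_near F u w y : (\forall z \near y, u z = w z) ->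
  sub2_at F u y -> sub2_at F w y.
Proof.
move=> uw uF c p A sA wy wle; apply: (uF c p A sA).
  by rewrite (nbhs_singleton uw).
by have := near_and uw wle; apply: filterS => z [->].
Qed.

Lemma sub2_at_max F u w y : sub2_at F u y -> sub2_at F w y ->
  sub2_at F (fun z => maxe (u z) (w z)) y.
Proof.
move=> uF wF c p A sA; rewrite /maxe; case: ifPn => _ uy mle.
  apply: (wF c p A sA uy); move: mle; apply: filterS => z.
  by apply: le_trans; rewrite le_max lexx orbT.
apply: (uF c p A sA uy); move: mle; apply: filterS => z.
by apply: le_trans; rewrite le_max lexx.
Qed.

Lemma sub2_at_shift F u y k a : sub2_at F u (y + k) ->
  sub2_at F (fun z => u (z + k)%R - a%:E)%E y.
Proof.
move=> uF c p A sA uy ule; apply: (uF (c + a) p A sA).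
  by rewrite EFinD -uy subeK.
move: ule; move=> /nbhs_norm_subP[d d0 dP]; apply/nbhs_norm_subP; exists d => // z zd.
have := dP (z - k); rewrite subrK opprD [- y - k]addrC addrA in zd *.
move=> /(_ zd); rewrite lee_subel_addr// => /le_trans; apply.
by rewrite -EFinD lee_fin /quad; lra.
Qed.

Definition Fpos F := forall A P, F A -> psd P -> F (A + P).

(* If a quadratic polynomial with Hessian [B] touches [g] from above, then
[B - A >= 0]: compare the two expansions at [y + t h] and [y - t h]. *)
Lemma sub2_at_smooth F g y p A : Fpos F -> A^T = A -> F A ->
  jet2 g y p A -> sub2_at F (fun z => (g z)%:E) y.
Proof.
move=> Fp sA FA gj c q B sB [gy] gle.
suff AB : psd (B - A) by rewrite -[B](subrK A) addrC; exact: Fp.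
split; first by rewrite /Defs.symmetric linearB /= sA sB.
move=> h; rewrite -qfE; apply/ler_addgt0Pr => e e0.
have [->|h0] := eqVneq h 0; first by rewrite qf0 add0r ltW.
have hh := dot_gt0 h0.
have e'0 : 0 < e / (2 * dot h h) by rewrite divr_gt0// mulr_gt0.
have /nbhs_norm_subP[d d0 dP] := near_and gle (gj _ e'0).
pose t := d / (2 * (`|h| + 1)).
have nh : 0 < `|h| by rewrite normr_gt0.
have t0 : 0 < t by rewrite divr_gt0// mulr_gt0// addr_gt0.
have td : t * `|h| < d.
  rewrite /t mulrAC ltr_pdivrMr ?mulr_gt0 ?addr_gt0// ltr_pM2l//; lra.
have main s : `|s| = t -> 0 <= s * dot (q - p) h + s ^+ 2 * (2^-1 * qf (B - A) h)
    + e / (2 * dot h h) * (s ^+ 2 * dot h h).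
  move=> st; have := dP (y + s *: h); rewrite addrC addKr normrZ st => /(_ td) [].
  rewrite lee_fin ler_norml => h1 /andP[h2 _]; move: h1 h2.
  rewrite /quad -gy !dotZr !qfZr !dotZl dotDl dotNl qfDl qfNl.
  by set X := e / _; nra.
have := main t (ger0_norm (ltW t0)).
have := main (- t); rewrite normrN ger0_norm ?(ltW t0)// => /(_ erefl).
rewrite sqrrN => h1 h2.
have : 0 <= t ^+ 2 * (qf (B - A) h + e).
  have -> : e = 2 * (e / (2 * dot h h) * dot h h) by field; rewrite gt_eqF.
  move: h1 h2; set X := e / _ ; nra.
by rewrite pmulr_rge0// exprn_gt0.
Qed.

End Subsolutions.

(** * Semicontinuity, comparison with strict supersolutions, gluing *)

Section Semicontinuity.
Variables (R : realType) (n : nat).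
Notation V := 'rV[R]_n.
Notation M := 'M[R]_n.
Implicit Types (f g : V -> R) (u v w : V -> \bar R) (p h k x y z : V).
Implicit Types (A B : M) (a c d e s t : R) (F : set M) (X K S : set V).

Definition usc_at K u x := forall c, (u x < c%:E)%E ->
  \forall z \near x, K z -> (u z < c%:E)%E.

Lemma usc_onP K u : usc_on K u <->
  (forall x, K x -> (u x < +oo)%E) /\ (forall x, K x -> usc_at K u x).
Proof.
split=> -[uoo uK]; split=> // x Kx c ux.
  by apply/nbhs_enormP; have [d d0 dP] := uK x Kx c ux; exists d => // z /[swap] /dP.
by have /nbhs_enormP[d d0 dP] := uK x Kx c ux; exists d => // z /[swap] /dP.
Qed.

Lemma usc_at_near K u w x : K x -> (\forall z \near x, K z -> u z = w z) ->
  usc_at K u x -> usc_at K w x.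
Proof.
move=> Kx uw uK c; rewrite -(nbhs_singleton uw)// => /uK uc.
by have := near_and uw uc; apply: filterS => z [h1 h2] Kz; rewrite -h1//; exact: h2.
Qed.

Lemma usc_at_max K u w x : usc_at K u x -> usc_at K w x ->
  usc_at K (fun z => maxe (u z) (w z)) x.
Proof.
move=> uK wK c; rewrite gt_max => /andP[/uK uc /wK wc].
have := near_and uc wc; apply: filterS => z [h1 h2] Kz.
by rewrite gt_max h1//= h2.
Qed.

Lemma usc_at_continuous K g x : {for x, continuous g} ->
  usc_at K (fun z => (g z)%:E) x.
Proof.
move=> /continuous_atP gx c; rewrite lte_fin -subr_gt0 => /gx.
apply: filterS => z /ltr_normlW; rewrite lte_fin => ? _; lra.
Qed.

Lemma lte_real_between (a b : \bar R) : (a < b)%E ->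
  exists2 c, (a < c%:E)%E & (c%:E <= b)%E.
Proof.
case: a b => [a| |] [b| |] // ab.
- by exists b.
- by exists (a + 1); rewrite ?leey// lte_fin ltrDl.
- by exists b.
- by exists 0; rewrite ?leey ?ltNyr.
Qed.

Lemma lte_room (a : \bar R) c : (a < c%:E)%E ->
  exists2 e, 0 < e & (a < (c - e)%:E)%E.
Proof.
case: a => [a| |] // ac; last by exists 1; rewrite ?ltNyr.
exists ((c - a) / 2); move: ac; rewrite !lte_fin => ac; lra.
Qed.

Lemma usc_at_sub K u g x : usc_at K u x -> {for x, continuous g} ->
  usc_at K (fun z => u z - (g z)%:E)%E x.
Proof.
move=> uK /continuous_atP gx c; rewrite lteBlDr// -EFinD => /lte_room[e e0 /uK uc].
have := near_and uc (gx e e0); apply: filterS => z [h1 h2] Kz.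
rewrite lteBlDr// -EFinD; apply: lt_le_trans (h1 Kz) _.
by rewrite lee_fin; move: h2 => /ltr_normlP[]; lra.
Qed.

(* If the maximum were not attained, the sets where [u] is at least [u x] would
form a filter base on [K] along which [near_covering] fails. *)
Lemma usc_max K u : compact K -> K !=set0 -> (forall x, K x -> usc_at K u x) ->
  exists2 x, K x & forall z, K z -> (u z <= u x)%E.
Proof.
move=> cK [x0 Kx0] uK; apply: contrapT => nmax.
have {}nmax x : K x -> exists2 z, K z & (u x < u z)%E.
  move=> Kx; apply: contrapT => nz; apply: nmax; exists x => // z Kz.
  by rewrite leNgt; apply/negP => xz; apply: nz; exists z.
pose B x := [set z | K z /\ (u x <= u z)%E].
pose FF := filter_from K B.
have FFilter : Filter FF.
  apply: filter_from_filter; first by exists x0.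
  move=> x y Kx Ky; have [xy|/ltW yx] := leP (u x) (u y).
    by exists y => // z [Kz yz]; split; split=> //; exact: le_trans yz.
  by exists x => // z [Kz xz]; split; split=> //; exact: le_trans xz.
have := (compact_near_coveringP K).1 cK V FF (fun z x => K x -> (u x < u z)%E) FFilter.
case=> [x Kx|z Kz].
  have [z Kz xz] := nmax x Kx; have [c xc cz] := lte_real_between xz.
  exists ([set x' | K x' -> (u x' < c%:E)%E], B z) => /=.
    by split; [exact: uK|exists z].
  move=> [x' z'] /= [xc' [_ zz']] Kx'; apply: lt_le_trans (xc' Kx') _.
  exact: le_trans cz zz'.
move=> /(_ z (conj Kz (lexx _)) z Kz Kz); rewrite ltxx//.
Qed.

Lemma usc_argmax K u g : compact K -> K !=set0 ->
  (forall x, K x -> usc_at K u x) -> (forall x, K x -> {for x, continuous g}) ->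
  exists2 y, K y & forall z, K z -> (u z - (g z)%:E <= u y - (g y)%:E)%E.
Proof.
move=> cK K0 uK gK; apply: (@usc_max K (fun z => u z - (g z)%:E)%E) => // x Kx.
by apply: usc_at_sub; [exact: uK | exact: gK].
Qed.

Lemma compact_cball_norm x s : compact [set z : V | `|z - x| <= s].
Proof.
apply: bounded_closed_compact.
  exists (s + `|x|); split; first exact: num_real.
  move=> r sr z /= zs; rewrite -(subrK x z) (le_trans (ler_normD _ _))//.
  by rewrite (le_trans _ (ltW sr))// lerD2r.
move=> z zcl; rewrite /= leNgt; apply/negP => sz.
have zx0 : 0 < `|z - x| - s by rewrite subr_gt0.
have [y [/= ys yz]] := zcl _ (near_norm_lt z zx0).
have := ler_normD (y - x) (z - y); rewrite addrC addrA subrK.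
move: ys yz; rewrite [`|y - z|]distrC; lra.
Qed.

Lemma argmax_touch F K u g y p A c : closed F -> nbhs y K ->
  (forall z, K z -> (u z - (g z)%:E <= u y - (g y)%:E)%E) ->
  u y = c%:E -> A^T = A -> jet2 g y p A -> sub2_at F u y -> F A.
Proof.
move=> cF yK umax uy sA gj uF; apply: (sub2_at_jet cF uF sA gj uy).
apply: filterS yK => z /umax; rewrite uy -EFinB leeBlDr// -EFinD.
by rewrite addrC.
Qed.

(** A maximum of [u - g] where [u > g] cannot lie in [K] outside [X]; inside [X] it makes [g] plus a
    constant touch [u], which forces the Hessian of [g] into [F]. Positivity of the maximum also
    keeps [u y] away from [-oo], so that the test condition applies. *)
Lemma comparison F K X u g : closed F -> compact K -> open X -> X `<=` K ->
  usc_on K u -> (forall x, K x -> {for x, continuous g}) ->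
  (forall y, X y -> sub2_at F u y) ->
  (forall y, X y -> ((g y)%:E < u y)%E ->
     exists p A, [/\ A^T = A, jet2 g y p A & ~ F A]) ->
  (forall y, K y -> ~ X y -> (u y <= (g y)%:E)%E) ->
  forall z, K z -> (u z <= (g z)%:E)%E.
Proof.
move=> cF cK oX XK /usc_onP[uoo uK] gc uF gF ub z Kz.
rewrite leNgt; apply/negP => gu.
have [y Ky ymax] := usc_argmax cK (ex_intro _ z Kz) uK gc.
have gy : ((g y)%:E < u y)%E.
  by have := ymax z Kz; rewrite -sube_gt0 => /(lt_le_trans _); apply; rewrite sube_gt0.
have [Xy|nXy] := pselect (X y); last by have := ub y Ky nXy; rewrite leNgt gy.
have [p [A [sA gj nFA]]] := gF y Xy gy.
have [c uy] : exists c, u y = c%:E.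
  by move: (uoo y Ky) gy; case: (u y) => // c _ _; exists c.
apply: nFA; apply: (argmax_touch cF _ ymax uy sA gj (uF y Xy)).
by apply: filterS XK _; exact: open_nbhs_nbhs.
Qed.

Lemma jet2_quad c p A y x : A^T = A ->
  jet2 (fun z => quad c p A (z - y)) x (p + (x - y) *m A) A.
Proof.
move=> sA e e0; apply: filterE => z; have {1}-> : z - y = (x - y) + (z - x).
  by rewrite [RHS]addrC addrA subrK.
by rewrite (quad_shift _ _ _ _ sA) subrr normr0 mulr_ge0 ?dot_ge0 ?ltW.
Qed.

(** For [x] in [K] this is the limsup of [u] along [K], the value at [x] included; it is [+oo] where
    [u] has no local upper bound. *)
Definition usc_env K u x : \bar R :=
  ereal_inf [set c%:E | c in [set c | \forall z \near x, K z -> (u z <= c%:E)%E]].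

Lemma usc_env_ge K u x : K x -> (u x <= usc_env K u x)%E.
Proof. by move=> Kx; apply: le_ereal_inf_tmp => _ [c /nbhs_singleton uc <-]; exact: uc. Qed.

Lemma usc_env_le K u x c : (\forall z \near x, K z -> (u z <= c%:E)%E) ->
  (usc_env K u x <= c%:E)%E.
Proof. by move=> uc; apply: ereal_inf_lbound; exists c. Qed.

Lemma usc_env_usc K u x : usc_at K (usc_env K u) x.
Proof.
move=> c /ereal_inf_lt[_ [c' uc' <-] c'c].
have /nbhs_interior := uc'; apply: filterS => z /usc_env_le/le_lt_trans + _.
exact.
Qed.

Lemma usc_env_gt K u x c (P : set V) : (c%:E < usc_env K u x)%E -> nbhs x P ->
  exists z, [/\ P z, K z & (c%:E < u z)%E].
Proof.
move=> cu xP; apply: contrapT => nz; move: cu; rewrite ltNge => /negP; apply.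
apply: usc_env_le; apply: filterS xP => z Pz Kz; rewrite leNgt; apply/negP => cz.
by apply: nz; exists z.
Qed.

(* A test polynomial for the envelope, made strict by adding [e |h|^2 / 2], touches
some member of the family at a nearby point, with the same Hessian up to [e]. *)
Lemma usc_env_sub2 F K X (FF : set (V -> \bar R)) : closed F -> open X -> X `<=` K ->
  (forall u, FF u -> forall y, X y -> usc_at K u y /\ sub2_at F u y) ->
  forall y, X y -> sub2_at F (usc_env K (fun x => ereal_sup [set u x | u in FF])) y.
Proof.
move=> cF oX XK FFP y Xy; set H := fun _ => _.
move=> c p A sA Ey Ele; apply: (closed_addr_scalar cF) => e e0.
have /nbhs_norm_subP[d d0 dP] : \forall z \near y, X z /\
    (usc_env K H z <= (quad c p A (z - y))%:E)%E.
  by apply: near_and => //; exact: open_nbhs_nbhs.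
(* At distance [s] or more the strict polynomial [Q] exceeds the original one by at least
   [e / 2 * s ^+ 2], that is [4 * eta], while the maximum of [u - Q] will be above [- 2 * eta].
   Hence it is attained strictly inside the ball. *)
pose s := d / 2; pose eta := e * s ^+ 2 / 8.
have s0 : 0 < s by rewrite divr_gt0.
have eta0 : 0 < eta by rewrite divr_gt0// mulr_gt0// exprn_gt0.
pose Ae := A + (2 * (e / 2))%:M.
have sAe : Ae^T = Ae by apply: symD => //; exact: sym_scalar.
pose Q z := quad c p Ae (z - y).
have Qc : continuous Q by exact: continuous_quad.
pose Bs := [set z : V | `|z - y| <= s].
have BP z : Bs z -> X z /\ (usc_env K H z <= (quad c p A (z - y))%:E)%E.
  by move=> zs; apply: dP; apply: le_lt_trans zs _; rewrite /s; lra.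
have uE u z : FF u -> Bs z -> (u z <= (quad c p A (z - y))%:E)%E.
  move=> FFu Bz; have [Xz] := BP z Bz; apply: le_trans.
  apply: le_trans (usc_env_ge _ (XK _ Xz)); apply: ereal_sup_ubound.
  by exists u.
have [z0 [[Bz0 Qz0] Kz0 /ereal_sup_gt[_ [u FFu <-] uz0]]] :
    exists z, [/\ Bs z /\ `|Q z - Q y| < eta, K z & ((c - eta)%:E < H z)%E].
  apply: (@usc_env_gt K H y); first by rewrite Ey lte_fin gtrBl.
  apply: near_and; last by have /continuous_atP := Qc y; apply.
  by apply: filterS (near_norm_lt y s0) => z /ltW.
have Qy : Q y = c by rewrite /Q subrr quad0.
have [x Bx xmax] : exists2 x, Bs x &
    forall z, Bs z -> (u z - (Q z)%:E <= u x - (Q x)%:E)%E.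
  apply: (usc_argmax _ _ _ (fun x _ => Qc x));
    [exact: compact_cball_norm|by exists z0|].
  move=> z Bz a ua; have [Xz _] := BP z Bz; have [uz _] := FFP u FFu z Xz.
  have XX : nbhs z X by exact: open_nbhs_nbhs.
  by have := near_and XX (uz a ua); apply: filterS => z' [/XK] ? + _; apply.
have ux : ((Q x - 2 * eta)%:E < u x)%E.
  have : ((- (2 * eta))%:E < u x - (Q x)%:E)%E.
    apply: lt_le_trans (xmax z0 Bz0); rewrite lteBrDr// -EFinD.
    apply: le_lt_trans uz0; rewrite lee_fin -Qy.
    by move: Qz0 => /ltr_normlW; rewrite Qy; lra.
  by rewrite lteBrDr// -EFinD addrC.
have xs : `|x - y| < s.
  rewrite ltNge; apply/negP => sx.
  have := lt_le_trans ux (uE u x FFu Bx); rewrite lte_fin /Q quad_add_scalar.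
  have : s ^+ 2 <= dot (x - y) (x - y).
    by apply: le_trans (sqr_norm_le_dot _); rewrite lerXn2r ?nnegrE ?(ltW s0).
  rewrite -(ler_pM2l e0); move: eta0; rewrite /eta; lra.
have [a uxa] : exists a, u x = a%:E.
  by move: ux (uE u x FFu Bx); case: (u x) => // a _ _; exists a.
have [Xx _] := BP x Bx; have [_ uF] := FFP u FFu x Xx.
have -> : e = 2 * (e / 2) by field.
apply: (argmax_touch cF _ xmax uxa sAe (jet2_quad c p y x sAe) uF).
have xs' : 0 < s - `|x - y| by rewrite subr_gt0.
apply: filterS (near_norm_lt x xs') => z zx; rewrite /Bs /=.
have := ler_normD (z - x) (x - y); rewrite addrA subrK; lra.
Qed.

Definition glue S u v z := if `[<S z>] then maxe (u z) (v z) else u z.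

(** Under either alternative the glued function is, near [x] in [K], simply the maximum of the two
    functions or simply [u]. *)
Definition glueable K S u v x := (\forall z \near x, S z) \/
  (\forall z \near x, K z -> S z -> (v z <= u z)%E).

Lemma glue_usc K S u v x : K x -> glueable K S u v x -> usc_at K u x ->
  (S x -> usc_at K v x) -> usc_at K (glue S u v) x.
Proof.
move=> Kx [Sx|vu] uK vK.
  apply: (@usc_at_near K (fun z => maxe (u z) (v z))) => //.
    by apply: filterS Sx => z Sz _; rewrite /glue asboolT.
  by apply: usc_at_max => //; apply: vK; exact: nbhs_singleton Sx.
apply: (@usc_at_near K u) => //; apply: filterS vu => z vu Kz.
by rewrite /glue; case: asboolP => // Sz; rewrite max_l// vu.
Qed.

Lemma glue_sub2 F K S u v x : nbhs x K -> glueable K S u v x -> sub2_at F u x ->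
  (S x -> sub2_at F v x) -> sub2_at F (glue S u v) x.
Proof.
move=> Kx [Sx|vu] uK vK.
  apply: (@sub2_at_near _ _ _ (fun z => maxe (u z) (v z))) => //.
    by apply: filterS Sx => z Sz; rewrite /glue asboolT.
  by apply: sub2_at_max => //; apply: vK; exact: nbhs_singleton Sx.
apply: (@sub2_at_near _ _ _ u) => //.
have := near_and Kx vu; apply: filterS => z [Kz {}vu].
by rewrite /glue; case: asboolP => // Sz; rewrite max_l// vu.
Qed.

(** A point outside the open ball has a neighbourhood of radius [s / 2] that meets the ball only in
    the annulus where [v <= u]. *)
Lemma glueable_ball K u v y s : 0 < s ->
  (forall z, K z -> s / 2 < `|z - y| -> `|z - y| < s -> (v z <= u z)%E) ->
  forall x, glueable K [set z | `|z - y| < s] u v x.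
Proof.
move=> s0 vu x; have [xs|sx] := ltP `|x - y| s; [left|right].
  have xs' : 0 < s - `|x - y| by rewrite subr_gt0.
  apply: filterS (near_norm_lt x xs') => z zx; rewrite /=.
  have := ler_normD (z - x) (x - y); rewrite addrA subrK; lra.
have s2 : 0 < s / 2 by rewrite divr_gt0.
apply: filterS (near_norm_lt x s2) => z zx Kz zs; apply: vu => //.
have := ler_normD (x - z) (z - y); rewrite addrA subrK [`|x - z|]distrC.
move: zs zx sx => /=; lra.
Qed.

End Semicontinuity.

(** * Perron's method and Walsh's translation argument *)

Section Perron.
Variables (R : realType) (n : nat).
Notation V := 'rV[R]_n.
Notation M := 'M[R]_n.
Variables (F : set M) (X K : set V) (b : V -> R).
Implicit Types (f g : V -> R) (u v w : V -> \bar R) (p h k x y z : V).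
Implicit Types (A B : M) (a c d e s t : R).

(** [K] stands for the closure of [X], its points outside [X] for the boundary, and [b] for the data
    on all boundary components at once. *)
Definition perron_family : set (V -> \bar R) :=
  [set u | usc_on K u /\ subharmonic F X u /\
           forall x, K x -> ~ X x -> (u x <= (b x)%:E)%E].

Definition perron x : \bar R := ereal_sup [set u x | u in perron_family].

Hypotheses (cF : closed F) (Fp : Fpos F).
Hypotheses (oX : open X) (cK : compact K) (XK : X `<=` K).
(** Each member is upper semicontinuous and below [b] on the boundary; the content is that the
    neighbourhood does not depend on [u], so that the estimate passes to the envelope of the
    supremum. *)
Hypothesis upper : forall x0 e, K x0 -> ~ X x0 -> 0 < e ->
  \forall z \near x0, forall u, perron_family u -> K z -> (u z <= (b x0 + e)%:E)%E.
Hypothesis lower : forall x0 e, K x0 -> ~ X x0 -> 0 < e ->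
  \forall z \near x0, K z -> ((b x0 - e)%:E <= perron z)%E.
Hypothesis bounded : exists C, forall u z, perron_family u -> K z -> (u z <= C%:E)%E.
Hypothesis perron_gtNy : forall z, K z -> (-oo < perron z)%E.

Lemma nbhsK x : X x -> nbhs x K.
Proof. by move=> Xx; apply: filterS XK _; exact: open_nbhs_nbhs. Qed.

Lemma perron_ge u z : perron_family u -> (u z <= perron z)%E.
Proof. by move=> uP; apply: ereal_sup_ubound; exists u. Qed.

Lemma perron_family_sub2 u :
  (forall x, K x -> (u x < +oo)%E) -> (forall x, K x -> usc_at K u x) ->
  (forall x, X x -> sub2_at F u x) ->
  (forall x, K x -> ~ X x -> (u x <= (b x)%:E)%E) -> perron_family u.
Proof.
move=> uoo uK uF ub; split; first exact/usc_onP.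
split=> //; apply: sub2_subharmonic => //; apply/usc_onP; split=> x Xx.
  by apply: uoo; exact: XK.
move=> c /(uK x (XK Xx)); apply: filterS => z h Xz; apply: h; exact: XK.
Qed.

Lemma perron_family_at u : perron_family u -> forall y, X y ->
  usc_at K u y /\ sub2_at F u y.
Proof.
move=> [/usc_onP[_ uK] [uF _]] y Xy; split; first by apply: uK; exact: XK.
exact: subharmonic_sub2 uF Xy.
Qed.

(** Walsh's translate, the bump in the dual condition and the lower barrier all enter the family
    through this lemma; [perron_glue_ge] then turns each of them into a lower bound for [perron]. *)
Lemma perron_family_glue S u v : perron_family u ->
  (forall x, K x -> glueable K S u v x) ->
  (forall x, K x -> ~ X x -> S x -> (v x <= (b x)%:E)%E) ->
  (forall x, K x -> S x -> usc_at K v x /\ (v x < +oo)%E) ->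
  (forall x, X x -> S x -> sub2_at F v x) ->
  perron_family (glue S u v).
Proof.
move=> [/usc_onP[uoo uK] [uF ub]] gl vb vK vF.
apply: perron_family_sub2 => [y Ky|y Ky|y Xy|y Ky nXy].
- rewrite /glue; case: asboolP => [Sy|_]; last exact: uoo.
  by rewrite gt_max uoo//; have [] := vK _ Ky Sy.
- apply: glue_usc; [by []|exact: gl|exact: uK|].
  by move=> Sy; have [] := vK _ Ky Sy.
- apply: (glue_sub2 (nbhsK Xy)); [by apply: gl; exact: XK| |exact: vF].
  exact: subharmonic_sub2 uF Xy.
- rewrite /glue; case: asboolP => [Sy|_]; last exact: ub.
  by rewrite ge_max ub//= vb.
Qed.

Lemma perron_glue_ge S u v x : perron_family (glue S u v) -> S x ->
  (v x <= perron x)%E.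
Proof.
by move=> /(@perron_ge _ x); rewrite /glue => + Sx; rewrite asboolT// ge_max => /andP[].
Qed.

Lemma perron_env z : K z -> usc_env K perron z = perron z.
Proof.
move=> Kz; apply/eqP; rewrite eq_le usc_env_ge// andbT; apply: perron_ge.
have [C uC] := bounded.
have EC x : (usc_env K perron x <= C%:E)%E.
  apply: usc_env_le; apply: filterE => y Ky; apply: ge_ereal_sup => _ [u uP <-].
  exact: uC.
apply: perron_family_sub2 => [x Kx|x Kx|x Xx|x Kx nXx].
- by apply: le_lt_trans (EC x) _; rewrite ltry.
- exact: usc_env_usc.
- exact: (usc_env_sub2 cF oX XK perron_family_at).
- apply/lee_addgt0Pr => e e0; rewrite -EFinD; apply: usc_env_le.
  have := upper Kx nXx e0; apply: filterS => y uy Ky.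
  by apply: ge_ereal_sup => _ [u uP <-]; exact: uy.
Qed.

Lemma perron_fin z : K z -> perron z \is a fin_num.
Proof.
move=> Kz; have [C uC] := bounded; rewrite fin_numElt perron_gtNy//=.
apply: le_lt_trans (ltry C); apply: ge_ereal_sup => _ [u uP <-].
exact: uC.
Qed.

Lemma perron_bdry x : K x -> ~ X x -> perron x = (b x)%:E.
Proof.
move=> Kx nXx; apply/eqP; rewrite eq_le; apply/andP; split.
  apply: ge_ereal_sup => _ [u [_ [_ ub]] <-]; exact: ub.
apply/lee_addgt0Pr => e e0.
have := nbhs_singleton (lower Kx nXx e0) Kx.
by rewrite EFinB leeBlDr.
Qed.

Lemma perron_family_perron : perron_family perron.
Proof.
apply: perron_family_sub2 => [x Kx|x Kx|x Xx|x Kx nXx].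
- by have := perron_fin Kx; rewrite fin_numElt => /andP[].
- apply: (@usc_at_near _ _ _ (usc_env K perron)) => //.
    by apply: filterE => z; exact: perron_env.
  exact: usc_env_usc.
- apply: (@sub2_at_near _ _ _ (usc_env K perron)).
    by have := nbhsK Xx; apply: filterS => z; exact: perron_env.
  exact: (usc_env_sub2 cF oX XK perron_family_at).
- by rewrite perron_bdry.
Qed.

(** [upper] and [lower], each with [e / 2], bound the oscillation of [perron] near one boundary
    point; compactness of the boundary makes the radius uniform. *)
Lemma perron_bdry_modulus e : 0 < e -> exists2 d, 0 < d &
  forall x0 x y, K x0 -> ~ X x0 -> K x -> K y -> `|x - x0| < d -> `|y - x0| < d ->
    (perron x <= perron y + e%:E)%E.
Proof.
move=> e0; pose N := K `&` ~` X.
have cN : compact N by apply: compact_closedI => //; exact: open_closedC.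
pose P d x0 := forall x y, K x -> K y -> `|x - x0| < d -> `|y - x0| < d ->
    (perron x <= perron y + e%:E)%E.
have e20 : 0 < e / 2 by rewrite divr_gt0.
have Pnear : \forall d \near (0 : R)^'+, N `<=` P d.
  apply: ((compact_near_coveringP N).1 cN) => x0 [Kx0 nXx0].
  have [r r0 rP] := (nbhs_norm_subP _ _).1
    (near_and (upper Kx0 nXx0 e20) (lower Kx0 nXx0 e20)).
  have r20 : 0 < r / 2 by rewrite divr_gt0.
  exists ([set z | `|z - x0| < r / 2], [set d | d < r / 2]) => /=.
    by split; [exact: near_norm_lt | exact: nbhs_right_lt].
  move=> [z d] /= [zx0 dr] x y Kx Ky xz yz.
  have near_x0 (q : V) : `|q - z| < d -> `|q - x0| < r.
    move=> tz; have := ler_normD (q - z) (z - x0); rewrite addrA subrK; lra.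
  have [/(_ _ _ Kx) xle _] := rP x (near_x0 x xz).
  have [_ /(_ Ky) yge] := rP y (near_x0 y yz).
  apply: ge_ereal_sup => _ [u uP <-]; apply: le_trans (xle u uP) _.
  rewrite -leeBlDr// -EFinB; apply: le_trans yge; rewrite lee_fin; lra.
have [d [dP d0]] := @filter_ex _ _ (at_right_proper_filter (0 : R)) _
  (filterI Pnear (nbhs_right_gt 0)).
by exists d => // x0 x y Kx0 nXx0; apply: dP.
Qed.

(* Walsh: the maximum of [perron] and of [perron (. + k) - e], where the latter is
defined, belongs to the family. *)
Lemma perron_modulus e : 0 < e -> exists2 d, 0 < d &
  forall x y, K x -> K y -> `|x - y| < d -> (perron x <= perron y + e%:E)%E.
Proof.
move=> e0; have [d d0 dP] := perron_bdry_modulus e0.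
exists (d / 2) => [|x' y Kx' Ky xy]; first by rewrite divr_gt0.
pose k := x' - y.
have kd : `|k| < d / 2 by [].
have {xy} -> : x' = y + k by rewrite addrC subrK.
have {Kx'} Kyk : K (y + k) by rewrite addrC subrK.
(* Since [|k| < d / 2], a boundary point within [d / 2] of [z] or of [z + k] is within [d] of
   both. *)
have dP1 x0 z : K x0 -> ~ X x0 -> K z -> K (z + k) ->
    `|z - x0| < d / 2 -> (perron (z + k)%R <= perron z + e%:E)%E.
  move=> Kx0 nXx0 Kz Kzk zx0; apply: (dP x0) => //; last by lra.
  by rewrite addrAC (le_lt_trans (ler_normD _ _))//; lra.
have dP2 x0 z : K x0 -> ~ X x0 -> K z -> K (z + k) ->
    `|z + k - x0| < d / 2 -> (perron (z + k)%R <= perron z + e%:E)%E.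
  move=> Kx0 nXx0 Kz Kzk zx0; apply: (dP x0) => //; first by lra.
  have -> : z - x0 = (z + k - x0) - k by rewrite [z + k - x0]addrAC addrK.
  by rewrite (le_lt_trans (ler_normB _ _))//; lra.
have d20 : 0 < d / 2 by rewrite divr_gt0.
(* If [y] or [y + k] is a boundary point, the boundary modulus applies at that very point; otherwise
   [y] belongs to [S]. *)
have [nXy|Xy] := pselect (~ X y); first by apply: (dP1 y); rewrite // subrr normr0.
have [nXyk|Xyk] := pselect (~ X (y + k)).
  by apply: (dP2 (y + k)); rewrite // subrr normr0.
move/contrapT : Xy => Xy; move/contrapT : Xyk => Xyk.
pose S := [set z | X z /\ X (z + k)].
have shift_near (P : set V) x : nbhs (x + k) P -> \forall z \near x, P (z + k).
  move=> /nbhs_norm_subP[r r0 rP]; apply/nbhs_norm_subP; exists r => // z zx.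
  by apply: rP; rewrite opprD addrACA subrr addr0.
have [/usc_onP[poo pK] [pF pb]] := perron_family_perron.
rewrite -leeBlDr//.
apply: (@perron_glue_ge S perron (fun z => perron (z + k)%R - e%:E)%E) => //.
apply: perron_family_glue => //;
    [exact: perron_family_perron|move=> x Kx|move=> x Kx nXx []//|move=> x Kx [Xx Xxk]|move=> x Xx [_ Xxk]].
- have [[Xx Xxk]|nS] := pselect (S x).
    left; apply: near_and; first exact: open_nbhs_nbhs.
    by apply: shift_near; exact: open_nbhs_nbhs.
  (* Off the open set [S], either [x] or [x + k] is a boundary point, where the boundary modulus
     gives the inequality nearby, or [x + k] is outside the closed set [K] and no point near [x] is
     in [S]. *)
  right; have [Xx|nXx] := pselect (X x); last first.
    apply: filterS (near_norm_lt x d20) => z zx Kz [Xz Xzk].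
    by rewrite leeBlDr//; apply: (dP1 x) => //; exact: XK.
  have [Kxk|nKxk] := pselect (K (x + k)).
    have nXxk : ~ X (x + k) by move=> ?; apply: nS.
    have : \forall z \near x, `|z + k - (x + k)| < d / 2.
      by apply: (shift_near (fun z => `|z - (x + k)| < d / 2)); exact: near_norm_lt.
    apply: filterS => z zx Kz [Xz Xzk].
    by rewrite leeBlDr//; apply: (dP2 (x + k)) => //; exact: XK.
  have : \forall z \near x, ~ K (z + k).
    apply: (shift_near (~` K)); apply: open_nbhs_nbhs; split => //.
    by apply: closed_openC; apply: compact_closed cK; exact: norm_hausdorff.
  by apply: filterS => z nKzk _ [_ /XK].
- split; last first.
    by rewrite lteBlDr// (lt_le_trans (poo _ (XK Xxk)))// leey.
  move=> c; rewrite lteBlDr// -EFinD => /(pK _ (XK Xxk)) /shift_near pc.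
  have : \forall z \near x, X (z + k) by apply: shift_near; exact: open_nbhs_nbhs.
  move=> /(near_and pc); apply: filterS => z [h /XK Kzk] _.
  by rewrite lteBlDr// -EFinD; exact: h.
- by apply: sub2_at_shift; exact: subharmonic_sub2 pF Xxk.
Qed.

Lemma perron_continuous : {within K, continuous perron}.
Proof.
apply/subspace_continuousP => x Kx.
suff : perron @ within K (nbhs x) --> (fine (perron x))%:E.
  by rewrite fineK// perron_fin.
apply: cvg_EFin.
  by apply: (@filterE _ (nbhs x)) => z; exact: perron_fin.
apply/cvgrPdist_lt => e e0; have e20 : 0 < e / 2 by rewrite divr_gt0.
have [d d0 dP] := perron_modulus e20.
apply: filterS (near_norm_lt x d0) => z zx Kz /=.
have := dP x z Kx Kz; rewrite distrC => /(_ zx).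
have := dP z x Kz Kx zx.
rewrite -(fineK (perron_fin Kx)) -(fineK (perron_fin Kz)) -!EFinD !lee_fin /= => h1 h2.
by rewrite ltr_norml; apply/andP; split; lra.
Qed.

(** If [- A] were interior to [F], then [- f], bent down by [e / 4 * |h|^2] and raised by [eta],
    would be a subsolution above [perron] at [y] and below it away from [y]; gluing it in would
    contradict maximality. *)
Lemma perron_dual_subharmonic : subharmonic (dualF F) X (fun x => - perron x)%E.
Proof.
split.
  apply/usc_onP; split=> x /XK Kx.
    by rewrite lteNl /= perron_gtNy.
  move=> c; rewrite lteNl => /[dup] cp.
  have [r px] : exists r, perron x = r%:E.
    by exists (fine (perron x)); rewrite fineK// perron_fin.
  rewrite px lte_fin -subr_gt0 => e0.
  have [d d0 dP] := perron_modulus (divr_gt0 e0 (ltr0n _ 2)).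
  apply: filterS (near_norm_lt x d0) => z zx /XK Kz.
  rewrite lteNl; have := dP x z Kx Kz; rewrite distrC => /(_ zx).
  rewrite px -leeBlDr// -EFinB; apply: lt_le_trans; rewrite lte_fin; lra.
move=> y f Xy [fC2 [fy fle]].
have [sA jf] := C2_near_jet2 fC2; set A := hess f y in sA jf *; set p := grad f y in jf.
split=> // -[_ [e e0 eF]].
have e80 : 0 < e / 8 by rewrite divr_gt0.
pose B := - A + (2 * (- (e / 4)))%:M.
have sB : B^T = B by apply: symD; [rewrite linearN /= sA|exact: sym_scalar].
have FB : F B.
  apply: eF => //; rewrite /B addrC addKr (le_lt_trans (norm_scalar_mx_le _ _))//.
  by rewrite ltr_norml; lra.
have {}fle : \forall z \near y, (- perron z <= (f z)%:E)%E.
  by apply/nbhs_enormP.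
have [s s0 sP] := (nbhs_norm_subP _ _).1
  (near_and (open_nbhs_nbhs (conj oX Xy)) (near_and fle (jf _ e80))).
(* The bend [e / 4 * |h|^2] beats the Taylor error [e / 8 * |h|^2] by at least [eta] as soon as
   [|h| >= s / 2]. *)
pose eta := e / 8 * (s ^+ 2 / 4).
have eta0 : 0 < eta by rewrite mulr_gt0// divr_gt0// exprn_gt0.
pose v z := quad (- f y + eta) (- p) B (z - y).
have py : perron y = (- f y)%:E by rewrite -[perron y]oppeK fy.
suff : (((v y)%:E) <= perron y)%E.
  by rewrite /v subrr quad0 py lee_fin; lra.
apply: (@perron_glue_ge [set z | `|z - y| < s] perron (fun z => (v z)%:E));
  last by rewrite /= subrr normr0.
apply: perron_family_glue; first exact: perron_family_perron.
- move=> x _; apply: glueable_ball => // z Kz sz zs; have [_ [fz jz]] := sP z zs.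
  rewrite leeNl in fz; apply: le_trans fz; rewrite -EFinN lee_fin /v.
  rewrite /B quad_add_scalar; move: jz; rewrite ler_norml => /andP[_].
  have : s ^+ 2 / 4 <= dot (z - y) (z - y).
    apply: le_trans (sqr_norm_le_dot _).
    have -> : s ^+ 2 / 4 = (s / 2) ^+ 2 by field.
    have s20 : 0 < s / 2 by rewrite divr_gt0.
    by rewrite lerXn2r ?nnegrE ?normr_ge0 ?(ltW sz) ?(ltW s20).
  rewrite -(ler_pM2l e80) /quad dotNl qfNl -/eta; lra.
- by move=> x Kx nXx /sP[].
- move=> x Kx xs; split; last by rewrite ltry.
  by apply: usc_at_continuous; exact: continuous_quad.
- by move=> x Xx xs; apply: (sub2_at_smooth Fp sB FB); exact: jet2_quad.
Qed.

Lemma perron_harmonic : F_harmonic F X perron.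
Proof.
split; [by move=> x /XK; exact: perron_fin| | |exact: perron_dual_subharmonic].
  exact: continuous_subspaceW XK perron_continuous.
by have [_ []] := perron_family_perron.
Qed.

End Perron.

(** * Barriers *)

Section Barriers.
Variables (R : realType) (n : nat).
Notation V := 'rV[R]_n.
Notation M := 'M[R]_n.
Implicit Types (f g q rho : V -> R) (u v w : V -> \bar R) (p h k x y z : V).
Implicit Types (A B : M) (a c d e s t : R) (F : set M) (X K : set V).

Lemma jet2D f g y p k A B : jet2 f y p A -> jet2 g y k B ->
  jet2 (fun z => f z + g z) y (p + k) (A + B).
Proof.
move=> fj gj e e0; have e20 : 0 < e / 2 by rewrite divr_gt0.
have := near_and (fj _ e20) (gj _ e20); apply: filterS => z [h1 h2].
have -> : f z + g z - quad (f y + g y) (p + k) (A + B) (z - y) =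
  (f z - quad (f y) p A (z - y)) + (g z - quad (g y) k B (z - y)).
  by rewrite /quad dotDl qfDl; ring.
by rewrite (le_trans (ler_normD _ _))// (splitr e) mulrDl lerD.
Qed.

Lemma jet2_affine f y p A a c : jet2 f y p A ->
  jet2 (fun z => a + c * f z) y (c *: p) (c *: A).
Proof.
move=> fj e e0; have c0 : 0 < `|c| + 1 by rewrite ltr_wpDl.
have := fj _ (divr_gt0 e0 c0); apply: filterS => z fz.
have -> : a + c * f z - quad (a + c * f y) (c *: p) (c *: A) (z - y) =
  c * (f z - quad (f y) p A (z - y)).
  by rewrite /quad dotZl qfZl; ring.
rewrite normrM (le_trans (ler_wpM2l _ fz))// mulrA ler_wpM2r ?dot_ge0//.
by rewrite mulrCA ger_pMr// ler_pdivrMr// mul1r lerDl.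
Qed.

(** Just enough regularity for an open condition on the Hessian at [x0] to hold for the jets at all
    nearby points. *)
Definition C2_at rho x0 :=
  (\forall z \near x0, differentiable rho z /\
     forall j, differentiable ('D_(evec R j) rho) z) /\
  (forall e, 0 < e -> \forall z \near x0, `|hess rho z - hess rho x0| < e).

Lemma C2_at_jet2 rho x0 : C2_at rho x0 -> \forall z \near x0,
  (hess rho z)^T = hess rho z /\ jet2 rho z (grad rho z) (hess rho z).
Proof.
move=> [/nbhs_interior rd _]; apply: filterS rd => z rd.
have [_ d2] := nbhs_singleton rd.
have d1 : \forall y \near z, differentiable rho y by apply: filterS rd => y [].
by split; [exact: hess_sym|exact: taylor2].
Qed.

Lemma C2_at_smooth (U : set V) rho x0 : open U -> U x0 -> smooth_on U rho ->
  C2_at rho x0.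
Proof.
move=> oU Ux sm; have UU : nbhs x0 U by exact: open_nbhs_nbhs.
have hessE z i j : hess rho z i j = dpart [:: i; j] rho z by rewrite mxE.
have subE (A B : M) i j : (A - B) i j = A i j - B i j by rewrite !mxE.
split.
  apply: filterS UU => z Uz; split=> [|j]; first exact: (sm [::] z Uz).
  exact: (sm [:: j] z Uz).
move=> e e0; have e20 : 0 < e / 2 by rewrite divr_gt0.
have : \forall z \near x0, forall i j, `|hess rho z i j - hess rho x0 i j| < e / 2.
  refine (@filter_forall V 'I_n (fun i z => forall j,
    `|hess rho z i j - hess rho x0 i j| < e / 2) _ (nbhs_filter x0) _) => i.
  refine (@filter_forall V 'I_n (fun j z =>
    `|hess rho z i j - hess rho x0 i j| < e / 2) _ (nbhs_filter x0) _) => j.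
  have /differentiable_continuous/continuous_atP/(_ _ e20) := sm [:: i; j] x0 Ux.
  by apply: filterS => z; rewrite !hessE.
apply: filterS => z h; apply: (@le_lt_trans _ _ (e / 2)); last by lra.
by apply: norm_le_coord => [|i j]; rewrite ?subE ltW.
Qed.

Lemma C2_at_quad c p A y x0 : A^T = A -> C2_at (fun z => quad c p A (z - y)) x0.
Proof.
move=> sA; split.
  apply: filterE => z; split=> [|j]; first exact: differentiable_quad.
  by rewrite derive_quad//; exact: differentiable_quad.
by move=> e e0; apply: filterE => z; rewrite !hess_quad// subrr normr0.
Qed.

Lemma qf_outer p h : qf (p^T *m p) h = dot p h ^+ 2.
Proof. by rewrite qfE mulmxA -mulmxA mxE big_ord1 -!dotE dotC expr2. Qed.

Lemma sym_outer p : (p^T *m p)^T = p^T *m p.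
Proof. by rewrite trmx_mul trmxK. Qed.

Lemma continuous_jet2 q z p A : A^T = A -> jet2 q z p A -> {for z, continuous q}.
Proof.
move=> sA qj; apply/continuous_atP => e e0; have e20 : 0 < e / 2 by rewrite divr_gt0.
have /continuous_atP/(_ _ e20) := @continuous_quad _ _ (q z) p A z sA z.
rewrite subrr quad0 => C1.
have Q2 : (2%:M : M)^T = 2%:M by exact: sym_scalar.
have /continuous_atP/(_ _ e20) := @continuous_quad _ _ 0 0 2%:M z Q2 z.
rewrite subrr quad0 => C2.
have := near_and C1 (near_and C2 (qj 1 ltr01)); apply: filterS => x [h1 [h2 h3]].
move: h2; rewrite subr0 /quad qf_scalar mulrA mulVf// mul1r add0r dotC dot0 add0r => h2.
rewrite mul1r in h3; rewrite -(subrKA (quad (q z) p A (x - z))).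
rewrite (le_lt_trans (ler_normD _ _))// (splitr e) ltrD//.
by apply: le_lt_trans h3 (ltr_normlW h2).
Qed.

(* [q = rho + (t/2) <grad rho, h>^2 - d |h|^2].  Here [rho] and [<grad rho, h>] differ
by [o(|h|)], and [rho + t rho^2 <= 0] when [-1/t <= rho <= 0]; the linear form is
used instead of [rho ^ 2] because the Hessian of its square is constant. *)
Lemma barrier_function K rho x0 t d (P : M -> Prop) :
  C2_at rho x0 -> rho x0 = 0 -> 0 < t -> 0 < d ->
  (\forall z \near x0, K z -> rho z <= 0) ->
  (\forall z \near x0, P (hess rho z +
     (t *: ((grad rho x0)^T *m grad rho x0) - (2 * d)%:M))) ->
  exists q s, [/\ 0 < s, q x0 = 0 & forall z, `|z - x0| < s ->
    (exists p A, [/\ A^T = A, jet2 q z p A & P A]) /\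
    (K z -> q z <= - (d / 2) * dot (z - x0) (z - x0))].
Proof.
move=> rC r0 t0 d0 rK PN; set g := grad rho x0 in PN; set N := _ - _ in PN.
have sN : N^T = N.
  by rewrite /N linearB /= linearZ /= sym_outer sym_scalar.
pose q z := rho z + quad 0 0 N (z - x0).
(* As [a <= 1], also [a ^+ 2 <= d / (2 * t)]; the expansion error of [rho], squared and multiplied
   by [t], then costs at most [d / 2 * |h|^2]. *)
pose a := Num.min 1 (d / (2 * t)).
have a0 : 0 < a by rewrite lt_min ltr01 divr_gt0// mulr_gt0.
have [rd _] := rC; have [rdx _] := nbhs_singleton rd.
have it0 : 0 < t^-1 by rewrite invr_gt0.
have /continuous_atP/(_ _ it0) := differentiable_continuous rdx; rewrite r0 => rc.
have [s s0 sP] := (nbhs_norm_subP _ _).1 (near_and (C2_at_jet2 rC) (near_and PN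
  (near_and rK (near_and rc (differentiable_expansion rdx a0))))).
exists q, s; split=> //; first by rewrite /q subrr quad0 r0 addr0.
move=> z /sP [[sH rj] [Pz [rz [rt re]]]]; split.
  exists (grad rho z + (0 + (z - x0) *m N)), (hess rho z + N); split => //.
    exact: symD.
  by apply: jet2D => //; exact: jet2_quad.
move=> /rz {}rz; rewrite r0 !subr0 in rt re; rewrite -/g in re.
rewrite /q /quad add0r [dot 0 _]dotC dot0 add0r /N qfDl qfNl qfZl qf_scalar qf_outer.
set l := dot g _ in re *; set D := dot _ _; set rh := rho z in rt rz re *.
have hD : `|z - x0| ^+ 2 <= D by exact: sqr_norm_le_dot.
have le2 : (rh - l) ^+ 2 <= d / (2 * t) * D.
  rewrite -real_normK ?num_real//.
  apply: (@le_trans _ _ ((a * `|z - x0|) ^+ 2)).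
    by rewrite lerXn2r ?nnegrE ?mulr_ge0 ?(ltW a0).
  rewrite exprMn; apply: ler_pM => //; rewrite ?sqr_ge0//.
  rewrite expr2; apply: (@le_trans _ _ (1 * a)).
    by rewrite ler_wpM2r ?(ltW a0)// ge_min lexx.
  by rewrite mul1r ge_min lexx orbT.
have {}le2 : t * (rh - l) ^+ 2 <= d / 2 * D.
  have -> : d / 2 * D = t * (d / (2 * t) * D) by field; rewrite gt_eqF.
  by rewrite ler_pM2l.
have rt1 : t * rh ^+ 2 <= - rh.
  move: rt; rewrite ler0_norm// => rt.
  have : t * (- rh) <= 1.
    by rewrite mulrC -ler_pdivlMr// mul1r ltW.
  have : 0 <= - rh by rewrite oppr_ge0.
  nra.
(* Multiplied by [t / 2], this bounds the steep term by [- rh + d / 2 * D]; adding [rh - d * D]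
   leaves [- d / 2 * D]. *)
have : l ^+ 2 <= 2 * rh ^+ 2 + 2 * (rh - l) ^+ 2.
  by have := sqr_ge0 (2 * rh - l); lra.
move=> /(ler_wpM2l (ltW t0)); nra.
Qed.

Lemma enorm_sqr h : enorm h ^+ 2 = dot h h.
Proof. by rewrite enorm_dot sqr_sqrtr// dot_ge0. Qed.

Lemma projP_normalized h : projP ((enorm h)^-1 *: h) = (dot h h)^-1 *: (h^T *m h).
Proof.
rewrite /projP !linearZ /= -scalemxAl scalerA -invfM -expr2 enorm_sqr//.
Qed.

Lemma enorm_normalized h : h != 0 -> enorm ((enorm h)^-1 *: h) = 1.
Proof.
move=> h0; rewrite enorm_dot dotZl dotZr mulrA -invfM -expr2 enorm_sqr.
by rewrite mulVf ?sqrtr1// gt_eqF// dot_gt0.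
Qed.

Definition Fcone F := forall A t, F A -> 0 < t -> F (t *: A).

(* Divide by [t |h|^2] and let [t] tend to infinity: [- P_e] would be in [F]. *)
Lemma steep_not_in F h A : closed F -> Fcone F ->
  (forall e : V, enorm e = 1 -> ~ F (- projP e)) -> h != 0 ->
  exists2 t, 0 < t & ~ F (- (A + t *: (h^T *m h))).
Proof.
move=> cF Fc nF h0; apply: contrapT => nt; apply: (nF _ (enorm_normalized h0)).
rewrite projP_normalized; set G := dot h h; have G0 : 0 < G by exact: dot_gt0.
apply: cF => U /nbhs_norm_subP[d d0 dU].
pose t := (`|A| + 1) / (d * G).
have A1 : 0 < `|A| + 1 by rewrite ltr_wpDl.
have t0 : 0 < t by rewrite divr_gt0// mulr_gt0.
exists ((t * G)^-1 *: - (A + t *: (h^T *m h))); split.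
  apply: Fc; last by rewrite invr_gt0 mulr_gt0.
  by apply: contrapT => nFt; apply: nt; exists t.
apply: dU.
have -> : (t * G)^-1 *: - (A + t *: (h^T *m h)) - - (G^-1 *: (h^T *m h)) =
   - (t * G)^-1 *: A.
  rewrite opprD scalerDr !scalerN scalerA invfM mulrAC mulVf ?mul1r ?gt_eqF//.
  by rewrite opprK subrK scaleNr.
rewrite normrZ normrN ger0_norm ?invr_ge0 ?(ltW (mulr_gt0 t0 G0))//.
have -> : (t * G)^-1 = d / (`|A| + 1) by rewrite /t; field; rewrite !gt_eqF.
rewrite mulrAC ltr_pdivrMr// ltr_pM2l//; lra.
Qed.

(** The function [b x0 + e / 2 - L * q] has Hessian outside [F] near [x0] and lies above every
    member on the rim of a small ball. Uniformity in [u] comes from the common bound [C], which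
    alone determines how large [L] must be once the ball is fixed. *)
Lemma upper_barrier F X K b rho x0 C e : closed F -> Fcone F ->
  (forall e : V, enorm e = 1 -> ~ F (- projP e)) ->
  open X -> compact K -> X `<=` K ->
  (forall e, 0 < e -> \forall z \near x0, K z -> ~ X z -> b z <= b x0 + e) ->
  (forall u z, perron_family F X K b u -> K z -> (u z <= C%:E)%E) ->
  C2_at rho x0 -> rho x0 = 0 -> grad rho x0 != 0 ->
  (\forall z \near x0, K z -> rho z <= 0) -> 0 < e ->
  \forall z \near x0, forall u, perron_family F X K b u -> K z ->
    (u z <= (b x0 + e)%:E)%E.
Proof.
move=> cF Fc nF oX cK XK bc uC rC r0 g0 rK e0; set g := grad rho x0 in g0.
(* The identity is subtracted in advance: it is the Hessian of the term [d |h|^2] of the barrier for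
   [d = 1 / 2]. *)
have [t t0 tF] := steep_not_in (hess rho x0 - 1%:M) cF Fc nF g0.
pose N := t *: (g^T *m g) - (2 * 2^-1)%:M.
have e20 : 0 < e / 2 by rewrite divr_gt0.
have PN : \forall z \near x0, ~ F (- (hess rho z + N)).
  have nFn : nbhs (- (hess rho x0 - 1%:M + t *: (g^T *m g))) (~` F).
    by apply: open_nbhs_nbhs; split => //; exact: closed_openC.
  have [d d0 dP] := (nbhs_norm_subP _ _).1 nFn.
  have [_ /(_ d d0)] := rC; apply: filterS => z zd; apply: dP.
  rewrite /N mulfV// -normrN.
  suff -> : - (- (hess rho z + (t *: (g^T *m g) - 1%:M)) -
    - (hess rho x0 - 1%:M + t *: (g^T *m g))) = hess rho z - hess rho x0 by [].
  move: (hess rho z) (hess rho x0) (t *: _) => A B N'.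
  by apply/matrixP => i j; rewrite !mxE; ring.
have d0 : 0 < 2^-1 :> R by rewrite invr_gt0.
have [q [s [s0 q0 sP]]] :=
  @barrier_function K rho x0 t 2^-1 (fun A => ~ F (- A)) rC r0 t0 d0 rK PN.
have [s' s'0 s'P] := (nbhs_norm_subP _ _).1 (bc _ e20).
pose r := Num.min s s' / 2.
have ss0 : 0 < Num.min s s' by rewrite lt_min s0.
have rr : 0 < r by rewrite divr_gt0.
have rs z : `|z - x0| <= r -> `|z - x0| < s /\ `|z - x0| < s'.
  move=> zr; have : `|z - x0| < Num.min s s' by rewrite /r in zr; lra.
  by rewrite lt_min => /andP[].
(* Where [|z - x0| = r] in [K], [q <= - r ^+ 2 / 4], so [- L * q] is at least [|C - b x0| + 1] and
   [w] exceeds [C]. *)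
pose L := (`|C - b x0| + 1) * 4 / r ^+ 2.
have L0 : 0 < L by rewrite divr_gt0 ?exprn_gt0// mulr_gt0// ltr_wpDl.
pose w z := (b x0 + e / 2) + (- L) * q z.
have qneg z : K z -> `|z - x0| <= r -> q z <= - (2^-1 / 2) * `|z - x0| ^+ 2.
  move=> Kz /rs[/sP[_ /(_ Kz)] qz _]; apply: (le_trans qz).
  by rewrite !mulNr lerN2 ler_pM2l ?sqr_norm_le_dot// divr_gt0.
have qc z : `|z - x0| < s -> {for z, continuous q}.
  by move=> /sP[[p [A [sA qj _]]] _]; exact: continuous_jet2 sA qj.
have wc z : `|z - x0| < s -> {for z, continuous w}.
  move=> /sP[[p [A [sA qj _]]] _]; apply: (@continuous_jet2 _ _ (- L *: p) (- L *: A)).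
    by rewrite linearZ /= sA.
  exact: jet2_affine.
pose K' := K `&` [set z | `|z - x0| <= r]; pose X' := X `&` [set z | `|z - x0| < r].
have uw u z : perron_family F X K b u -> K' z -> (u z <= (w z)%:E)%E.
  move=> uP; have [/usc_onP[uoo uK] [uF ub]] := uP.
  apply: (@comparison _ _ F K' X' u w).
  - by [].
  - apply: compact_closedI => //; apply: compact_closed (@compact_cball_norm _ _ _ _).
    exact: norm_hausdorff.
  - apply: openI => //; rewrite openE => y /= yr; have yr' : 0 < r - `|y - x0| by rewrite subr_gt0.
    apply: filterS (near_norm_lt y yr') => x xy /=.
    have := ler_normD (x - y) (y - x0); rewrite addrA subrK; lra.
  - by move=> y [Xy /ltW yr]; split; [exact: XK|].
  - apply/usc_onP; split=> [y [Ky _]|y [Ky _] c /(uK y Ky)]; first exact: uoo.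
    by apply: filterS => x h [Kx _]; exact: h.
  - by move=> y [_ /rs[ys _]]; exact: wc.
  - by move=> y [Xy _]; exact: subharmonic_sub2 uF Xy.
  - move=> y [Xy /ltW/rs[ys _]] _; have [[p [A [sA qj nA]]] _] := sP y ys.
    exists (- L *: p), (- L *: A); split; [by rewrite linearZ /= sA|exact: jet2_affine|].
    move=> /(@Fc _ L^-1); rewrite invr_gt0 scalerA mulrN mulVf ?gt_eqF// scaleN1r.
    by move=> /(_ L0).
  - move=> y [Ky yr] nX'y; have qy := qneg y Ky yr.
    have qy0 : q y <= 0 by apply: (le_trans qy); rewrite mulNr oppr_le0 mulr_ge0 ?sqr_ge0.
    have [Xy|nXy] := pselect (X y); last first.
      have [_ /s'P /(_ Ky nXy) by0] := rs y yr.
      apply: le_trans (ub y Ky nXy) _; rewrite lee_fin /w.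
      have : 0 <= - L * q y by rewrite mulNr -mulrN mulr_ge0 ?(ltW L0)// oppr_ge0.
      by lra.
    have yr' : `|y - x0| = r.
      by apply/eqP; rewrite eq_le yr/= leNgt; apply/negP => yr'; apply: nX'y.
    apply: le_trans (uC u y uP Ky) _; rewrite lee_fin /w.
    have : L * q y <= L * (- (2^-1 / 2) * r ^+ 2) by rewrite ler_pM2l// -yr'.
    have -> : L * (- (2^-1 / 2) * r ^+ 2) = - (`|C - b x0| + 1).
      by rewrite /L; field; rewrite gt_eqF.
    have := ler_norm (C - b x0); lra.
have x0s : `|x0 - x0| < s by rewrite subrr normr0.
have /continuous_atP/(_ _ e20) := wc x0 x0s.
have := near_norm_lt x0 rr => h1 h2; have := near_and h1 h2.
apply: filterS => z [/ltW zr wz] u uP Kz; apply: (le_trans (uw u z uP (conj Kz zr))).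
move: wz; rewrite /w q0 mulr0 addr0 lee_fin => /ltr_normlW; lra.
Qed.

(* Compare with [C' - x_i ^ 2], whose Hessian is [- 2 P_(e_i)]. *)
Lemma perron_bounded F X K b C (i : 'I_n) : closed F -> Fcone F ->
  (forall e : V, enorm e = 1 -> ~ F (- projP e)) ->
  open X -> compact K -> X `<=` K ->
  (forall x, K x -> ~ X x -> b x <= C) ->
  exists C', forall u z, perron_family F X K b u -> K z -> (u z <= C'%:E)%E.
Proof.
move=> cF Fc nF oX cK XK bC; have := compact_bounded cK => -[L [_ /(_ (`|L| + 1))]].
rewrite (le_lt_trans (ler_norm L)) ?ltrDl// => /(_ isT) KL.
pose A : M := (-2) *: ((evec R i)^T *m evec R i).
have sA : A^T = A by rewrite linearZ /= sym_outer.
pose g z := quad (C + (`|L| + 1) ^+ 2) 0 A (z - 0).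
have gE z : g z = C + (`|L| + 1) ^+ 2 - z ord0 i ^+ 2.
  by rewrite /g /quad subr0 dotC dot0 qfZl qf_outer dotC dot_evec; field.
have nFA : ~ F A.
  move=> /(@Fc _ 2^-1); rewrite scalerA mulrN mulVf// invr_gt0 scaleN1r => /(_ (ltr0Sn _ 1)).
  by apply: nF; rewrite enorm_dot dot_evec mxE !eqxx sqrtr1.
exists (C + (`|L| + 1) ^+ 2) => u z uP Kz.
have [uK [uF ub]] := uP.
have : (u z <= (g z)%:E)%E.
  apply: (comparison cF cK oX XK uK) => //.
  - by move=> x _; exact: continuous_quad.
  - by move=> y Xy; exact: subharmonic_sub2 uF Xy.
  - by move=> y Xy _; exists (0 + (y - 0) *m A), A; split => //; exact: jet2_quad.
  - move=> y Ky nXy; apply: le_trans (ub y Ky nXy) _; rewrite lee_fin gE.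
    have := bC y Ky nXy.
    have : y ord0 i ^+ 2 <= (`|L| + 1) ^+ 2.
      rewrite -real_normK ?num_real// lerXn2r ?nnegrE ?addr_ge0//.
      by apply: le_trans (coord_le_norm _ _ _) (KL y Ky).
    lra.
move=> /le_trans; apply; rewrite lee_fin gE gerBl sqr_ge0//.
Qed.

End Barriers.

(** * Lower barrier at a strictly convex boundary point *)

Section LowerBarrier.
Variables (R : realType) (n : nat).
Notation V := 'rV[R]_n.
Notation M := 'M[R]_n.
Implicit Types (q rho : V -> R) (u v w : V -> \bar R) (p h x y z : V).

(** By strict convexity the barrier with the opposite sign, [b x0 - e / 2 + L * q], has Hessian in
    [F] near [x0]. It falls below [m], hence below [u0], on the outer half of a small ball, which
    allows gluing it to [u0]. *)
Lemma lower_barrier (F : set M) (X K : set V) (b : V -> R) u0 rho x0 (m t0 e : R) :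
  closed F -> Fcone F -> Fpos F -> open X -> X `<=` K -> perron_family F X K b u0 ->
  (forall z, K z -> (m%:E <= u0 z)%E) ->
  (forall e, 0 < e -> \forall z \near x0, K z -> ~ X z -> b x0 - e <= b z) ->
  C2_at rho x0 -> rho x0 = 0 -> grad rho x0 != 0 ->
  (\forall z \near x0, K z -> rho z <= 0) ->
  (forall t, t0 <= t -> IntF F (hess rho x0 +
     t *: projP ((enorm (grad rho x0))^-1 *: grad rho x0))) -> 0 < e ->
  \forall z \near x0, K z -> ((b x0 - e)%:E <= perron F X K b z)%E.
Proof.
move=> cF Fc Fp oX XK u0P mu bc rC r0 g0 rK Fcvx e0; set g := grad rho x0 in g0 Fcvx.
have G0 : 0 < dot g g by exact: dot_gt0.
(* The maximum with 1 makes the steep coefficient positive, as [barrier_function] requires. *)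
pose tau := Num.max t0 1; have tau0 : 0 < tau by rewrite lt_max ltr01 orbT.
have [_ [d d0 dF]] : IntF F (hess rho x0 + tau *: projP ((enorm g)^-1 *: g)).
  by apply: Fcvx; rewrite le_max lexx.
have t1 : 0 < tau / dot g g by rewrite divr_gt0.
have d80 : 0 < d / 8 by rewrite divr_gt0.
have d20 : 0 < d / 2 by rewrite divr_gt0.
have e20 : 0 < e / 2 by rewrite divr_gt0.
(* The variation of the Hessian, below [d / 2], and the term [2 * (d / 8)] together stay within the
   radius [d] of the ball contained in [F]. *)
pose N := (tau / dot g g) *: (g^T *m g) - (2 * (d / 8))%:M.
have sN : N^T = N by rewrite /N linearB /= linearZ /= sym_outer sym_scalar.
have PN : \forall z \near x0, F (hess rho z + N).
  have [_ /(_ _ d20) hz] := rC; have := near_and (C2_at_jet2 rC) hz.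
  apply: filterS => z [[sH _] {}hz]; apply: dF; first exact: symD.
  rewrite projP_normalized scalerA /N.
  have -> : forall (A B C D : M), A + (B - C) - (D + B) = (A - D) - C.
    by move=> A B C D; apply/matrixP => i j; rewrite !mxE; ring.
  rewrite (le_lt_trans (ler_normB _ _))// (splitr d) ltr_leD//.
  rewrite (le_trans (norm_scalar_mx_le _ _))// ger0_norm; lra.
have [q [s [s0 q0 sP]]] :=
  @barrier_function _ _ K rho x0 _ _ (fun A => F A) rC r0 t1 d80 rK PN.
have [s' s'0 s'P] := (nbhs_norm_subP _ _).1 (bc _ e20).
pose r := Num.min s s'; have rr : 0 < r by rewrite lt_min s0.
have rs z : `|z - x0| < r -> `|z - x0| < s /\ `|z - x0| < s'.
  by rewrite lt_min => /andP[].
have r20 : 0 < r / 2 by rewrite divr_gt0.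
(* For [|z - x0| >= r / 2] one has [q <= - d * r ^+ 2 / 64], so [L * q] is at most
   [- (|b x0 - m| + 1)] and [v] drops below [m]. *)
pose L := (`|b x0 - m| + 1) * 64 / (d * r ^+ 2).
have L0 : 0 < L.
  by rewrite divr_gt0 ?mulr_gt0 ?exprn_gt0// ltr_wpDl.
pose v z := (b x0 - e / 2) + L * q z.
have qneg z : K z -> `|z - x0| < r -> q z <= - (d / 8 / 2) * `|z - x0| ^+ 2.
  move=> Kz /rs[/sP[_ /(_ Kz)] qz _]; apply: (le_trans qz).
  by rewrite !mulNr lerN2 ler_pM2l ?sqr_norm_le_dot// divr_gt0.
have vj z : `|z - x0| < r -> exists p A, [/\ A^T = A, jet2 v z p A & F A].
  move=> /rs[/sP[[p [A [sA qj FA]]] _] _]; exists (L *: p), (L *: A).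
  by split; [rewrite linearZ /= sA|exact: jet2_affine|exact: Fc].
have vc z : `|z - x0| < r -> {for z, continuous v}.
  by move=> /vj[p [A [sA vj' _]]]; exact: continuous_jet2 sA vj'.
pose S := [set z : V | `|z - x0| < r].
have x0S : S x0 by rewrite /S /= subrr normr0.
have FG : perron_family F X K b (glue S u0 (fun z => (v z)%:E)).
  apply: perron_family_glue => //.
  - move=> x _; apply: glueable_ball => // z Kz rz zr; apply: le_trans (mu z Kz).
    rewrite lee_fin /v; have := qneg z Kz zr.
    have : (r / 2) ^+ 2 <= `|z - x0| ^+ 2.
      by rewrite lerXn2r ?nnegrE ?(ltW r20) ?(ltW rz).
    have c0 : 0 < d / 8 / 2 by rewrite divr_gt0.
    rewrite -(ler_pM2l c0) => h1 h2.
    have : L * q z <= L * (- (d / 8 / 2 * (r / 2) ^+ 2)) by rewrite ler_pM2l//; lra.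
    have -> : L * (- (d / 8 / 2 * (r / 2) ^+ 2)) = - (`|b x0 - m| + 1).
      by rewrite /L; field; rewrite !gt_eqF.
    have := ler_norm (b x0 - m); lra.
  - move=> x Kx nXx xr; have [_ /s'P /(_ Kx nXx) bx] := rs x xr.
    have qx : q x <= 0.
      apply: (le_trans (qneg x Kx xr)).
      by rewrite mulNr oppr_le0 mulr_ge0 ?sqr_ge0// ltW// divr_gt0.
    rewrite lee_fin /v; have : L * q x <= 0 by rewrite pmulr_rle0.
    lra.
  - by move=> x Kx xr; split; [apply: usc_at_continuous; exact: vc|rewrite ltry].
  - by move=> x Xx /vj[p [A [sA jA FA]]]; exact: sub2_at_smooth jA.
have /continuous_atP/(_ _ e20) := vc x0 x0S.
have := near_norm_lt x0 rr => h1 h2; have := near_and h1 h2.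
apply: filterS => z [zr vz] Kz; apply: le_trans (perron_glue_ge FG zr).
rewrite lee_fin; move: vz; rewrite {2}/v q0 mulr0 addr0 => /ltr_normlP[]; lra.
Qed.

End LowerBarrier.

(** * Spheres, boundary of the domain with balls removed, relative continuity *)

Section AnnularDomain.
Variables (R : realType) (n : nat).
Notation V := 'rV[R]_n.
Implicit Types (c x y z : V) (r : R).

(** Negative outside the ball, as suits a domain from which the ball is removed; written as a [quad]
    to inherit its derivatives and jets. *)
Definition sphere_fun c r : V -> R := fun z => quad (r ^+ 2) 0 ((- 2)%:M) (z - c).

Lemma sphere_funE c r z : sphere_fun c r z = r ^+ 2 - dot (z - c) (z - c).
Proof. by rewrite /sphere_fun /quad dotC dot0 qf_scalar; field. Qed.

Lemma sphere_fun_sym : ((- 2)%:M : 'M[R]_n)^T = (- 2)%:M.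
Proof. exact: sym_scalar. Qed.

Lemma continuous_sphere_fun c r : continuous (sphere_fun c r).
Proof. exact: continuous_quad sphere_fun_sym. Qed.

Lemma cball_sphere_fun c r z : 0 <= r -> cball c r z <-> 0 <= sphere_fun c r z.
Proof. by move=> r0; rewrite /cball /= enorm_le// sphere_funE subr_ge0. Qed.

Lemma grad_sphere_fun_neq0 c r z : 0 < r -> sphere_fun c r z = 0 ->
  grad (sphere_fun c r) z != 0.
Proof.
move=> r0 z0; apply/eqP => g0.
suff zc : z = c by move: z0; rewrite sphere_funE zc subrr dot0 subr0 => /eqP;
  rewrite sqrf_eq0 gt_eqF.
apply/eqP; rewrite -subr_eq0; apply/eqP/rowP => j.
have := congr1 (fun h : V => h ord0 j) g0; rewrite !mxE derive_quadE ?sphere_fun_sym//.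
rewrite /quad qfE mulmx0 mul0mx !mxE mulr0 addr0 add0r dotC.
have -> : row j ((- 2)%:M : 'M[R]_n) = (- 2) *: evec R j.
  by apply/rowP => i; rewrite !mxE eqxx /= mulr_natr eq_sym.
rewrite dotZr dot_evec !mxE => /eqP; rewrite mulf_eq0 oppr_eq0 pnatr_eq0 /=.
by move/eqP.
Qed.

Lemma near_sphere_fun_gt c r z : 0 < sphere_fun c r z ->
  \forall y \near z, 0 < sphere_fun c r y.
Proof.
move=> z0; have /continuous_atP/(_ _ z0) := @continuous_sphere_fun c r z.
by apply: filterS => y /ltr_normlP[]; lra.
Qed.

Lemma near_sphere_fun_lt c r z : sphere_fun c r z < 0 ->
  \forall y \near z, sphere_fun c r y < 0.
Proof.
rewrite -oppr_gt0 => z0.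
have /continuous_atP/(_ _ z0) := @continuous_sphere_fun c r z.
by apply: filterS => y /ltr_normlP[]; lra.
Qed.

Lemma closed_bigcup_cball k (xs : 'I_k -> V) r : 0 <= r ->
  closed (\bigcup_j cball (xs j) r).
Proof.
move=> r0; rewrite -openC openE => x nDx; rewrite /interior.
have : \forall z \near x, forall j, sphere_fun (xs j) r z < 0.
  refine (@filter_forall V 'I_k (fun j z => sphere_fun (xs j) r z < 0) _
    (nbhs_filter x) _) => j.
  apply: near_sphere_fun_lt; rewrite ltNge; apply/negP => xj.
  by apply: nDx; exists j => //; apply/cball_sphere_fun.
apply: filterS => z zj [j _ /cball_sphere_fun] => /(_ r0).
by rewrite leNgt zj.
Qed.

Lemma local_defining_le0 (Om K : set V) rho (U : set V) : K `<=` closure Om ->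
  open U -> smooth_on U rho -> (forall y, U y -> (Om y <-> rho y < 0)) ->
  forall z, U z -> K z -> rho z <= 0.
Proof.
move=> KOm oU sm Urho z Uz /KOm Omz; rewrite leNgt; apply/negP => rz.
have /differentiable_continuous/continuous_atP/(_ _ rz) := sm [::] z Uz.
move=> /(near_and (open_nbhs_nbhs (conj oU Uz))) /Omz [y [Omy [Uy /ltr_normlP[]]]].
by have := (Urho y Uy).1 Omy; rewrite /=; lra.
Qed.

Lemma bdry_open_notin (Om : set V) x : open Om -> bdry Om x -> ~ Om x.
Proof. by move=> oO [_ nx] Ox; apply: nx; exact: open_nbhs_nbhs. Qed.

Lemma bdry_closed_in (D : set V) x : closed D -> bdry D x -> D x.
Proof. by move=> cD [/cD]. Qed.

(** Identifies the boundary of the Perron argument with the two boundaries of the theorem: a point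
    of [bdry Om] has a neighbourhood missing [D], a point of [bdry D] has one inside [Om]. *)
Lemma bdry_setD (Om D : set V) x : open Om -> closed D -> D `<=` Om ->
  closure (Om `\` D) x /\ ~ (Om `\` D) x <-> bdry Om x \/ bdry D x.
Proof.
move=> oO cD DO; split=> [[clx nx]|[[clx nOx]|[clx nDx]]].
- have [Ox|nOx] := pselect (Om x).
    have Dx : D x by apply: contrapT => nDx; apply: nx.
    right; split; first exact: subset_closure.
    by move=> /clx[y [[_ nDy]]].
  left; split; last by move=> /nbhs_singleton.
  by move=> U /clx[y [[Oy _] Uy]]; exists y.
- have nO : ~ Om x by exact: bdry_open_notin (conj clx nOx).
  split; last by move=> [].
  have nDn : nbhs x (~` D).
    by apply: open_nbhs_nbhs; split; [exact: closed_openC|move=> /DO].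
  by move=> U /(near_and nDn)/clx[y [Oy [nDy Uy]]]; exists y.
- have Dx : D x by exact: cD.
  split; last by move=> [].
  move=> U Ux; apply: contrapT => nU; apply: nDx.
  have := near_and Ux (open_nbhs_nbhs (conj oO (DO x Dx))).
  apply: filterS => y [Uy Oy]; apply: contrapT => nDy.
  by apply: nU; exists y.
Qed.

Lemma within_continuous_near (A : set V) (f : V -> R) x (e : R) :
  {within A, continuous f} -> A x -> 0 < e ->
  \forall z \near x, A z -> `|f z - f x| < e.
Proof.
move=> /subspace_continuousP fA Ax e0.
have /cvgrPdist_lt/(_ e e0) := fA x Ax.
by apply: (@filterS _ (nbhs x)) => z h Az; rewrite distrC; exact: h.
Qed.

Lemma within_continuous_fine_near (A : set V) (f : V -> \bar R) x (e : R) :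
  {within A, continuous f} -> A x -> f x \is a fin_num -> 0 < e ->
  \forall z \near x, A z -> `|fine (f z) - fine (f x)| < e.
Proof.
move=> /subspace_continuousP fA Ax fx e0.
have : f @ within A (nbhs x) --> (fine (f x))%:E by rewrite fineK//; exact: fA.
move=> /fine_cvg/cvgrPdist_lt/(_ e e0).
by apply: (@filterS _ (nbhs x)) => z h Az; rewrite distrC; exact: h.
Qed.

End AnnularDomain.


(** * The Dirichlet problem on the domain with the balls removed *)

Theorem theorem6p1 (R : realType) (n : nat) (F : set 'M[R]_n)
  (Om : set 'rV[R]_n) (k : nat) (xs : 'I_k -> 'rV[R]_n) (r0 : R)
  (phi : 'rV[R]_n -> R) (psi : 'rV[R]_n -> \bar R) (r : R) :
  cone_subequation F ->
  (forall e : 'rV[R]_n, enorm e = 1 -> ~ F (- projP e)) ->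
  domain Om -> bounded_set Om -> strictly_F_convex_boundary F Om ->
  (0 < k)%N -> injective xs -> (forall j, Om (xs j)) ->
  0 < r0 ->
  (forall j, cball (xs j) r0 `<=` Om) ->
  (forall i j, i != j -> cball (xs i) r0 `&` cball (xs j) r0 = set0) ->
  {within bdry Om, continuous phi} ->
  subharmonic F Om psi ->
  (forall x, bdry Om x -> (psi x <= (phi x)%:E)%E) ->
  ( (* polar case *)
    ((forall x, closure Om x -> (psi x < +oo)%E) /\
     {within closure Om, continuous psi} /\
     (forall x, closure Om x -> (psi x = -oo)%E <-> exists j, x = xs j))
  \/ (* finite case *)
    ((forall x, closure Om x -> psi x \is a fin_num) /\
     {within closure Om, continuous psi} /\
     (forall j, strict_local_min psi (xs j)) /\
     (forall j, forall f, ~ test_fun psi (xs j) f)) ) ->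
  0 < r -> r <= r0 ->
  let Dr := \bigcup_j cball (xs j) r in
  let Omr := Om `\` Dr in
  let Fr := [set u : 'rV[R]_n -> \bar R |
               usc_on (closure Omr) u /\ subharmonic F Omr u /\
               (forall x, bdry Dr x -> (u x <= psi x)%E) /\
               (forall x, bdry Om x -> (u x <= (phi x)%:E)%E)] in
  let H := fun x => ereal_sup [set u x | u in Fr] in
  [/\ (forall x, closure Omr x -> H x \is a fin_num),
      {within closure Omr, continuous H},
      F_harmonic F Omr H,
      (forall x, bdry Dr x -> H x = psi x) &
      (forall x, bdry Om x -> H x = (phi x)%:E)].
Proof.
move=> [Fsym cF Fp' Ft] nF [oO [_ _]] Obd [Osm Ocvx] k0 _ _ r00 ballO _ phic psiF
  psiphi psicase rr rr0 Dr X Fr H.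
have Fp : Fpos F by exact: Fp'.
have Fc : Fcone F by move=> A t FA t0; rewrite -(Ft t t0); exists A.
have cD : closed Dr by apply: closed_bigcup_cball; exact: ltW.
have DO : Dr `<=` Om.
  by move=> x [j _ xj]; apply: (ballO j); exact: le_trans xj rr0.
have oX : open X by apply: openI => //; exact: closed_openC.
pose K := closure X.
have XK : X `<=` K by exact: subset_closure.
have XO : X `<=` Om by move=> x [].
have KO : K `<=` closure Om by exact: closure_subset.
have cK : compact K.
  apply: bounded_closed_compact; last exact: closed_closure.
  have [C [Cr CO]] := Obd.
  exists C; split=> // C' CC' x /KO clx; apply/ler_addgt0Pr => e e0.
  have [y [Oy xy]] := clx _ (near_norm_lt x e0).
  have := ler_normD y (x - y); rewrite addrC subrK; have := CO C' CC' y Oy.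
  by move: xy; rewrite /= distrC; lra.
(* The centres are interior to [Dr], hence off the closure [K]; this makes [psi] finite on [K] in
   the polar case. *)
have nxs x j : K x -> x <> xs j.
  move=> Kx xj; have xs0 : 0 < sphere_fun (xs j) r (xs j).
    by rewrite sphere_funE subrr dot0 subr0 exprn_gt0.
  have /Kx[y [[_ nDy] /ltW y0]] : nbhs x [set y | 0 < sphere_fun (xs j) r y].
    by rewrite xj; exact: near_sphere_fun_gt.
  by apply: nDy; exists j => //; apply/cball_sphere_fun => //; exact: ltW.
have psic : {within closure Om, continuous psi} by case: psicase => -[_ []].
have psifin x : K x -> psi x \is a fin_num.
  move=> Kx; case: psicase => [[poo [_ pNy]]|[pf _]]; last exact: pf (KO x Kx).
  rewrite fin_numElt poo ?andbT; last exact: KO.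
  rewrite ltNye; apply/eqP => /(pNy x (KO x Kx))[j]; exact: nxs.
have psinear x e : K x -> 0 < e -> \forall z \near x, K z ->
    `|fine (psi z) - fine (psi x)| < e.
  move=> Kx e0; have := within_continuous_fine_near psic (KO x Kx) (psifin x Kx) e0.
  by apply: filterS => z h /KO; exact: h.
(* Membership in [Om] tells the two boundaries apart, since [Dr] lies in the open set [Om]. Each has
   a neighbourhood free of the other, whence the relative continuity [bnear]. *)
pose b x := if `[<Om x>] then fine (psi x) else phi x.
have bD x : bdry Dr x -> (b x)%:E = psi x.
  move=> xD; have Dx := bdry_closed_in cD xD.
  rewrite /b asboolT; last exact: DO.
  by rewrite fineK// psifin//; have [] := (bdry_setD x oO cD DO).2 (or_intror xD).
have bO x : bdry Om x -> b x = phi x.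
  by move=> xO; rewrite /b asboolF//; exact: bdry_open_notin xO.
have FrE : Fr = perron_family F X K b.
  apply/seteqP; split=> u.
    move=> [uK [uF [uD uO]]]; split=> //; split=> // x Kx nXx.
    have [xO|xD] := (bdry_setD x oO cD DO).1 (conj Kx nXx).
      by rewrite bO//; exact: uO.
    by rewrite bD//; exact: uD.
  move=> [uK [uF ub]]; split=> //; split=> //; split=> x xb.
    by rewrite -bD//; have [Kx nXx] := (bdry_setD x oO cD DO).2 (or_intror xb); exact: ub.
  by rewrite -bO//; have [Kx nXx] := (bdry_setD x oO cD DO).2 (or_introl xb); exact: ub.
have -> : H = perron F X K b by rewrite /H FrE.
(* Besides the lower bound near the spheres, this keeps [perron] above [-oo] and provides the
   function [u0] glued in at the outer boundary. *)
have psiP : perron_family F X K b psi.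
  rewrite -FrE; split; [|split; [|split=> //]].
  - apply/usc_onP; split=> x Kx.
      by have := psifin x Kx; rewrite fin_numElt => /andP[].
    move=> c; rewrite -(fineK (psifin x Kx)) lte_fin -subr_gt0 => /(psinear x _ Kx).
    apply: filterS => z h Kz; rewrite -(fineK (psifin z Kz)) lte_fin.
    have /ltr_normlW := h Kz; lra.
  - have [/usc_onP[poo pK] pF] := psiF; split; last by move=> y f /XO; exact: pF.
    apply/usc_onP; split=> x /XO Ox; first exact: poo.
    by move=> c /(pK x Ox); apply: filterS => z h /XO; exact: h.
have bnear x0 e : K x0 -> ~ X x0 -> 0 < e ->
    \forall z \near x0, K z -> ~ X z -> `|b z - b x0| < e.
  move=> Kx0 nXx0 e0; have [xO|xD] := (bdry_setD x0 oO cD DO).1 (conj Kx0 nXx0).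
    have nDn : nbhs x0 (~` Dr).
      apply: open_nbhs_nbhs; split; first exact: closed_openC.
      by move=> /DO; exact: bdry_open_notin xO.
    have := near_and nDn (within_continuous_near phic xO e0).
    apply: filterS => z [nDz h] Kz nXz.
    have [zO|zD] := (bdry_setD z oO cD DO).1 (conj Kz nXz).
      by rewrite !bO//; exact: h.
    by have := nDz (bdry_closed_in cD zD).
  have Ox0 : Om x0 by apply: DO; exact: bdry_closed_in xD.
  have := near_and (open_nbhs_nbhs (conj oO Ox0)) (psinear x0 e Kx0 e0).
  by apply: filterS => z [Oz h] Kz _; rewrite /b !asboolT//; exact: h.
have bup x0 : K x0 -> ~ X x0 -> forall e, 0 < e ->
    \forall z \near x0, K z -> ~ X z -> b z <= b x0 + e.
  move=> Kx nXx e e0; have := bnear x0 e Kx nXx e0; apply: filterS => z h Kz nXz.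
  by have /ltr_normlW := h Kz nXz; lra.
have blo x0 : K x0 -> ~ X x0 -> forall e, 0 < e ->
    \forall z \near x0, K z -> ~ X z -> b x0 - e <= b z.
  move=> Kx nXx e e0; have := bnear x0 e Kx nXx e0; apply: filterS => z h Kz nXz.
  by have /ltr_normlP[] := h Kz nXz; lra.
have [B bB] : exists B, forall x, K x -> ~ X x -> b x <= B.
  pose N := K `&` ~` X.
  have cN : compact N by apply: compact_closedI => //; exact: open_closedC.
  have [N0|N0] := pselect (N !=set0); last first.
    by exists 0 => x Kx nXx; exfalso; apply: N0; exists x.
  have [x Nx bx] : exists2 x, N x & forall z, N z -> ((b z)%:E <= (b x)%:E)%E.
    apply: usc_max => // x [Kx nXx] c; rewrite lte_fin -subr_gt0.
    move=> /(bnear x _ Kx nXx); apply: filterS => z h [Kz nXz].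
    by rewrite lte_fin; have /ltr_normlW := h Kz nXz; lra.
  by exists (b x) => z Kz nXz; rewrite -lee_fin; apply: bx.
have bounded : exists C, forall u z, perron_family F X K b u -> K z -> (u z <= C%:E)%E.
  (* For [n = 0] the whole space is the single point [xs j], which [K] avoids; so [K] is empty.
     Otherwise a coordinate exists for [perron_bounded]. *)
  have [n0|/negP n0] := pselect (n == 0%N); last first.
    move: n0; rewrite -lt0n => n0.
    exact: (perron_bounded (Ordinal n0) cF Fc nF oX cK XK bB).
  exists 0 => u z _ Kz; exfalso; apply: (nxs z (Ordinal k0) Kz).
  by apply/rowP => i; have := ltn_ord i; rewrite [X in (_ < X)%N](eqP n0).
have [m mpsi] : exists m, forall z, K z -> (m%:E <= psi z)%E.
  have [K0|K0] := pselect (K !=set0); last first.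
    by exists 0 => x Kx; exfalso; apply: K0; exists x.
  have [x Kx px] : exists2 x, K x &
      forall z, K z -> ((- fine (psi z))%:E <= (- fine (psi x))%:E)%E.
    apply: usc_max => // x Kx c; rewrite lte_fin -subr_gt0.
    move=> /(psinear x _ Kx); apply: filterS => z h Kz.
    by rewrite lte_fin; have /ltr_normlP[] := h Kz; lra.
  exists (fine (psi x)) => z Kz; rewrite -(fineK (psifin z Kz)) lee_fin.
  by have := px z Kz; rewrite lee_fin lerN2.
have defO x0 : bdry Om x0 -> exists rho, [/\ local_defining_fun Om x0 rho,
    C2_at rho x0, rho x0 = 0, grad rho x0 != 0 &
    \forall z \near x0, K z -> rho z <= 0].
  move=> xO; have [rho Lrho] := Osm x0 xO; exists rho.
  have [U [oU Ux sm gU rU]] := Lrho.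
  have [Kx _] := (bdry_setD x0 oO cD DO).2 (or_introl xO).
  have le0 := local_defining_le0 KO oU sm rU.
  split=> //; [exact: C2_at_smooth sm| |exact: gU|].
    apply/eqP; rewrite eq_le le0//= leNgt; apply/negP => /(rU x0 Ux).2.
    exact: bdry_open_notin xO.
  by have := open_nbhs_nbhs (conj oU Ux); apply: filterS => z Uz; exact: le0.
have upper x0 e : K x0 -> ~ X x0 -> 0 < e -> \forall z \near x0,
    forall u, perron_family F X K b u -> K z -> (u z <= (b x0 + e)%:E)%E.
  move=> Kx nXx e0; have [C uC] := bounded.
  have [xO|xD] := (bdry_setD x0 oO cD DO).1 (conj Kx nXx).
    have [rho [_ rC r0' rg rK]] := defO x0 xO.
    exact: (upper_barrier cF Fc nF oX cK XK (bup x0 Kx nXx) uC rC r0' rg rK e0).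
  (* On an inner sphere [sphere_fun] takes the place of [rho]: points of [K] are limits of points
     outside the ball, where it is negative. *)
  have [j _ xj] := bdry_closed_in cD xD.
  have sK z : K z -> sphere_fun (xs j) r z <= 0.
    move=> Kz; rewrite leNgt; apply/negP => z0.
    have /Kz[y [[_ nDy] /ltW y0]] := near_sphere_fun_gt z0.
    by apply: nDy; exists j => //; apply/cball_sphere_fun => //; exact: ltW.
  have s0 : sphere_fun (xs j) r x0 = 0.
    apply/eqP; rewrite eq_le sK//=; apply/cball_sphere_fun => //; exact: ltW.
  apply: (upper_barrier cF Fc nF oX cK XK (bup x0 Kx nXx) uC (rho := sphere_fun (xs j) r)) => //.
  - exact: C2_at_quad (sphere_fun_sym _ _).
  - exact: grad_sphere_fun_neq0.
  - by apply: filterE.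
have psi_le z : (psi z <= perron F X K b z)%E by exact: perron_ge.
have lower x0 e : K x0 -> ~ X x0 -> 0 < e -> \forall z \near x0, K z ->
    ((b x0 - e)%:E <= perron F X K b z)%E.
  move=> Kx nXx e0; have [xO|xD] := (bdry_setD x0 oO cD DO).1 (conj Kx nXx).
    have [rho [Lrho rC r0' rg rK]] := defO x0 xO.
    have [t0 cvx] := Ocvx x0 rho xO Lrho.
    exact: (lower_barrier cF Fc Fp oX XK psiP mpsi (blo x0 Kx nXx) rC r0' rg rK cvx e0).
  have := psinear x0 e Kx e0; apply: filterS => z h Kz; apply: le_trans (psi_le z).
  rewrite EFinB bD// -(fineK (psifin x0 Kx)) -(fineK (psifin z Kz)) -EFinB lee_fin.
  by have /ltr_normlP[] := h Kz; lra.
have gtNy z : K z -> (-oo < perron F X K b z)%E.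
  move=> Kz; apply: lt_le_trans (psi_le z).
  by have := psifin z Kz; rewrite fin_numElt => /andP[].
split.
- exact: (perron_fin bounded gtNy).
- exact: (perron_continuous cF oX cK XK upper lower bounded gtNy).
- exact: (perron_harmonic cF Fp oX cK XK upper lower bounded gtNy).
- move=> x xD; have [Kx nXx] := (bdry_setD x oO cD DO).2 (or_intror xD).
  by rewrite (perron_bdry lower Kx nXx) bD.
- move=> x xO; have [Kx nXx] := (bdry_setD x oO cD DO).2 (or_introl xO).
  by rewrite (perron_bdry lower Kx nXx) bO.
Qed.
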